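(* Fix an integer $k\ge 1$. For a word $\omega=d_1\cdots d_k\in D^k$ let $g_\omega=g_{d_1}\circ\cdots\circ g_{d_k}$. Let $\mathcal A_k=\{g_\omega:\omega\in D^k\}$ be the set of distinct weak maps arising from words of length $k$, and put $M_h=\#\{\omega\in D^k: g_\omega=h\}$ for $h\in\mathcal A_k$. If the one-dimensional iterated function system $\mathcal A_k$ satisfies the open set condition, then $$\dim_{\mathrm H} K=\frac{1}{k\log m}\log\left(\sum_{h\in\mathcal A_k}M_h^\beta\right).$$
   Context: Let $2\le m<n$ be integers, let $D\subset\{0,\ldots,n-1\}\times\{0,\ldots,m-1\}$ be a non-empty digit set, and put $\beta=\log m/\log n$. For each digit $d=(i,j)\in D$ choose signs $\sigma_d,\eta_d\in\{-1,1\}$ and define $$S_d(x,y)=\left(\frac{\sigma_d x+a_d}{n},\frac{\eta_d y+b_d}{m}\right),$$ where $a_d=i$ if $\sigma_d=1$ and $a_d=i+1$ if $\sigma_d=-1$; and $b_d=j$ if $\eta_d=1$ and $b_d=j+1$ if $\eta_d=-1$. The reflected carpet $K$ is the attractor of $\{S_d:d\in D\}$, i.e. the unique non-empty compact set $K\subset\mathbb R^2$ with $K=\bigcup_{d\in D}S_d(K)$. The weak-coordinate map associated to $d\in D$ is the map $g_d:\mathbb R\to\mathbb R$, $g_d(y)=(\eta_d y+b_d)/m$. A finite set $\mathcal A$ of contracting similarities of $\mathbb R$ satisfies the open set condition if there is a non-empty bounded open set $U\subset\mathbb R$ with $h(U)\subset U$ for all $h\in\mathcal A$ and $h(U)\cap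 h'(U)=\varnothing$ for all distinct $h,h'\in\mathcal A$. $\dim_{\mathrm H}$ denotes Hausdorff dimension. *)

(* Defs.v *)
From mathcomp Require Import all_boot all_order all_algebra.
From mathcomp Require Import all_classical all_reals all_analysis.

Set Implicit Arguments.
Unset Strict Implicit.
Unset Printing Implicit Defensive.

Import Order.TTheory GRing.Theory Num.Theory.
Import numFieldNormedType.Exports.

Local Open Scope classical_set_scope.
Local Open Scope ring_scope.

(* MathComp-Analysis equips R * R with the sup norm, whence an explicit
   Euclidean distance. *)
Definition plane_dist (R : realType) (p q : R * R) : R :=
  Num.sqrt ((p.1 - q.1) ^+ 2 + (p.2 - q.2) ^+ 2).

(* Adjoining 0 only matters for the empty set, whose supremum would be -oo. *)
Definition diam (R : realType) (T : Type) (dist : T -> T -> R) (A : set T)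
    : \bar R :=
  ereal_sup (0%E |` [set (dist x y)%:E | x in A & y in A]).

(* The weight diam(A)^s of a covering set.  The empty set has weight 0 also for
   s = 0, while 0 `^ 0 = 1 is the right weight of a singleton. *)
Definition diam_pow (R : realType) (T : Type) (dist : T -> T -> R) (s : R)
    (A : set T) : \bar R :=
  if `[< A = set0 >] then 0%E else (diam dist A `^ s)%E.

Definition delta_cover (R : realType) (T : Type) (dist : T -> T -> R)
    (delta : R) (A : set T) (U : nat -> set T) : Prop :=
  A `<=` \bigcup_i U i /\ forall i, (diam dist (U i) <= delta%:E)%E.

Definition hausdorff_premeasure (R : realType) (T : Type) (dist : T -> T -> R)
    (s delta : R) (A : set T) : \bar R :=
  ereal_inf [set (\sum_(0 <= i <oo) diam_pow dist s (U i))%E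
            | U in [set U | delta_cover dist delta A U]].

(* The premeasure is nonincreasing in delta, so its limit as delta -> 0+ is
   this supremum. *)
Definition hausdorff_measure (R : realType) (T : Type) (dist : T -> T -> R)
    (s : R) (A : set T) : \bar R :=
  ereal_sup [set hausdorff_premeasure dist s delta A
            | delta in [set delta : R | 0 < delta]].

Definition hausdorff_dim (R : realType) (T : Type) (dist : T -> T -> R)
    (A : set T) : \bar R :=
  ereal_inf [set s%:E | s in
    [set s : R | 0 <= s /\ hausdorff_measure dist s A = 0%E]].

Definition open_set_condition (R : realType) (F : set (R -> R)) : Prop :=
  exists U : set R,
    [/\ U !=set0, bounded_set U, open U,
        forall h, F h -> h @` U `<=` U
      & forall h h', F h -> F h' -> h <> h' -> h @` U `&` h' @` U = set0].

(* A digit is d = (d.1, d.2) = (i, j). *)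
Notation digit n m := ('I_n * 'I_m)%type.

Definition shift_a (R : realType) (n m : nat) (sigma : digit n m -> R)
    (d : digit n m) : R :=
  if sigma d == 1 then d.1%:R else d.1.+1%:R.

Definition shift_b (R : realType) (n m : nat) (eta : digit n m -> R)
    (d : digit n m) : R :=
  if eta d == 1 then d.2%:R else d.2.+1%:R.

Definition weak_map (R : realType) (n m : nat) (eta : digit n m -> R)
    (d : digit n m) (y : R) : R :=
  (eta d * y + shift_b eta d) / m%:R.

Definition carpet_map (R : realType) (n m : nat) (sigma eta : digit n m -> R)
    (d : digit n m) (p : R * R) : R * R :=
  ((sigma d * p.1 + shift_a sigma d) / n%:R,
   (eta d * p.2 + shift_b eta d) / m%:R).

Definition is_reflected_carpet (R : realType) (n m : nat)
    (D : {set digit n m}) (sigma eta : digit n m -> R) (K : set (R * R))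
    : Prop :=
  [/\ K !=set0, compact K
    & K = \bigcup_(d in [set` D]) (carpet_map sigma eta d @` K)].

Definition words (n m : nat) (D : {set digit n m}) (k : nat)
    : {set k.-tuple (digit n m)} :=
  [set w : k.-tuple (digit n m) | all (fun d => d \in D) w]%SET.

(* word_map eta [:: d_1; ...; d_k] = g_{d_1} \o ... \o g_{d_k} *)
Definition word_map (R : realType) (n m : nat) (eta : digit n m -> R)
    (w : seq (digit n m)) : R -> R :=
  foldr (fun d f => weak_map eta d \o f) id w.

Definition weak_maps (R : realType) (n m : nat) (D : {set digit n m})
    (eta : digit n m -> R) (k : nat) : set (R -> R) :=
  [set word_map eta w | w in [set` words D k]].

Definition multiplicity (R : realType) (n m : nat) (D : {set digit n m})
    (eta : digit n m -> R) (k : nat) (h : R -> R) : nat :=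
  #|[set w in words D k | `[< word_map eta w = h >]]%SET|.

(* Main.v *)
(* Upper bound: the approximate square coded by l = floor (beta q) letters of
   D^k followed by q - l letters of A_k has side m^(-kq), and McMullen's Bernoulli
   weights satisfy, for every point of K and infinitely many q, weight >= (Z e^eps)^-q
   with Z = sum_h M_h^beta.  Only such squares are used to cover K, and their
   weights of a given level q sum to at most 1.
   Lower bound: by pigeonhole on the types (letter counts) of the words of length
   L over A_k, some type carries the share Z^L / (L + 1)^#A_k of
   sum_h M_h^beta.  The words of D^k of that type form a subsystem in which all T
   weak maps have the same multiplicity P and T P^beta is at least that share.
   For such a uniform subsystem no measure is needed: a finite cover of K by boxes
   is compared with the number (T P)^Q of words of a large length Q, since the open
   set condition bounds the number of approximate squares meeting a box of their
   size. *)
Require Import Defs.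
From mathcomp Require Import all_boot all_order all_algebra.
From mathcomp Require Import all_classical all_reals all_analysis.
From mathcomp Require Import zify ring lra.
Import Order.TTheory GRing.Theory Num.Theory.
Import numFieldNormedType.Exports.
Local Open Scope classical_set_scope.
Local Open Scope ring_scope.

Set Implicit Arguments.
Unset Strict Implicit.
Unset Printing Implicit Defensive.

(** * Compositions along words, and words grouped into blocks *)

Definition comp_word (W T : Type) (f : W -> T -> T) (w : seq W) : T -> T :=
  foldr (fun d g => f d \o g) id w.

Lemma comp_word_cat (W T : Type) (f : W -> T -> T) (u v : seq W) (x : T) :
  comp_word f (u ++ v) x = comp_word f u (comp_word f v x).
Proof. by elim: u => //= d u IH; rewrite IH. Qed.

Lemma comp_word_flatten (W T I : Type) (f : W -> T -> T) (j : I -> seq W)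
    (u : seq I) (x : T) :
  comp_word (fun t => comp_word f (j t)) u x = comp_word f (flatten (map j u)) x.
Proof. by elim: u => //= d u IH; rewrite comp_word_cat IH. Qed.

Lemma size_flatten_const (W I : Type) (j : I -> seq W) (L : nat)
    (hj : forall t, size (j t) = L) (u : seq I) :
  size (flatten (map j u)) = (L * size u)%N.
Proof.
by elim: u => [|a u IH] /=; rewrite ?muln0 // size_cat IH hj mulnS.
Qed.

Lemma flatten_const_inj (W : Type) (I : eqType) (j : I -> seq W) (L : nat)
    (hj : forall t, size (j t) = L) (hinj : injective j) (u u' : seq I) :
  size u = size u' -> flatten (map j u) = flatten (map j u') -> u = u'.
Proof.
elim: u u' => [|a u IH] [|a' u'] //= [hs] h.
have h1 : j a = j a'.
  by have := congr1 (take L) h; rewrite !take_size_cat ?hj.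
have h2 : flatten (map j u) = flatten (map j u').
  by have := congr1 (drop L) h; rewrite !drop_size_cat ?hj.
by rewrite (hinj _ _ h1) (IH _ hs h2).
Qed.

(** * Similarities of the line and separation of cylinders *)

Section Similarities.
Context {R : realType}.
Implicit Types (N : R) (q : nat).

Definition similarities (W : Type) (f : W -> R -> R) N : Prop :=
  forall w x y, `|f w x - f w y| = `|x - y| / N.

Lemma comp_word_similar (W : Type) (f : W -> R -> R) N :
  similarities f N -> forall u x y,
  `|comp_word f u x - comp_word f u y| = `|x - y| / N ^+ size u.
Proof.
move=> hf; elim=> [|d u IH] x y /=; first by rewrite expr0 divr1.
by rewrite hf IH exprS invfM mulrA mulrAC.
Qed.

(** A quantitative trace of the open set condition, asked only of words with the same [tau]-image. A
    constant [tau] compares all words of equal length; when [tau] gives the weak map of a letter,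
    horizontal separation is needed only inside a fibre. *)
Definition separated (W : Type) (H : Type) (tau : W -> H) (f : W -> R -> R) N
    : Prop :=
  exists rho v0 : R, 0 < rho /\ forall u u' : seq W, size u = size u' ->
    map tau u = map tau u' -> u <> u' ->
    rho / N ^+ size u <= `|comp_word f u v0 - comp_word f u' v0|.

Lemma comp_word_surj (W : Type) (f : W -> R -> R) :
  (forall w z, exists x, f w x = z) ->
  forall u z, exists x, comp_word f u x = z.
Proof.
move=> hs; elim=> [|d u IH] z /=; first by exists z.
by have [y <-] := hs d z; have [x <-] := IH y; exists x.
Qed.

(** [V] contains a ball of radius [rho] about [v0], and [u] carries it onto a ball of radius
    [rho / N ^+ size u]. If the images of [v0] were closer than that, the images of [V] under [u]
    and [u'] would meet, against the disjointness forced by the first differing letter. *)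
Lemma osc_separated (W : eqType) (H : Type) (tau : W -> H) (f : W -> R -> R) N
    (V : set R) : 0 < N ->
  similarities f N -> (forall w z, exists x, f w x = z) ->
  V !=set0 -> open V -> (forall w x, V x -> V (f w x)) ->
  (forall w w', tau w = tau w' -> w <> w' ->
     forall x y, V x -> V y -> f w x <> f w' y) ->
  separated tau f N.
Proof.
move=> N0 hsim hsurj [v0 Vv0] oV hV hdis.
have [rho /= rho0 hrho] : exists2 rho : R, 0 < rho &
    forall y, `|v0 - y| < rho -> V y.
  by have /nbhs_ballP[r /= r0 h] := oV _ Vv0; exists r => // y hy; exact: h.
have hVw : forall u x, V x -> V (comp_word f u x).
  by elim=> //= d u IH x Vx; apply/hV/IH.
have inj : forall w x y, f w x = f w y -> x = y.
  move=> w x y e; have := hsim w x y; rewrite e subrr normr0 => /esym/eqP.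
  by rewrite mulf_eq0 invr_eq0 (gt_eqF N0) orbF normr_eq0 subr_eq0 => /eqP.
have disj : forall u u' : seq W, size u = size u' -> map tau u = map tau u' ->
    u <> u' -> forall x y, V x -> V y -> comp_word f u x <> comp_word f u' y.
  elim=> [|d u IH] [|d' u'] //= [hs] [ht hts] hne x y Vx Vy.
  have [e|/eqP ne] := eqVneq d d'; last by apply: hdis => //; exact: hVw.
  rewrite -e => /inj; apply: IH => //.
  by move=> eu; apply: hne; rewrite e eu.
exists rho, v0; split=> // u u' hs ht hne; rewrite leNgt; apply/negP => hlt.
have [y hy] := comp_word_surj hsurj u (comp_word f u' v0).
apply: (disj u u' hs ht hne y v0 _ Vv0 hy).
apply: hrho; move: hlt; rewrite -hy (comp_word_similar hsim).
by rewrite ltr_pM2r // invr_gt0 exprn_gt0.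
Qed.

(** Flattening turns block words into longer words over [W], distinct ones into distinct ones since
    all blocks have length [L]. Through [p], equal block types give equal letter types. *)
Lemma separated_blocks (W H : eqType) (I J : eqType) (tau : W -> H)
    (f : W -> R -> R) N (L : nat) (j : I -> seq W) (p : J -> seq H)
    (tau' : I -> J) :
  (forall t, size (j t) = L) -> injective j ->
  (forall t, map tau (j t) = p (tau' t)) ->
  separated tau f N ->
  separated tau' (fun t => comp_word f (j t)) (N ^+ L).
Proof.
move=> hj jinj hp [rho [v0 [rho0 hsep]]]; exists rho, v0; split=> //.
move=> u u' hs ht hne; rewrite !comp_word_flatten -exprM -(size_flatten_const hj).
apply: hsep; first by rewrite !(size_flatten_const hj) hs.
- have e v : map tau (flatten (map j v)) = flatten (map p (map tau' v)).
    by elim: v => //= t v IH; rewrite map_cat hp IH.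
  by rewrite !e ht.
- by move=> /(flatten_const_inj hj jinj) -/(_ hs).
Qed.

Lemma similarities_blocks (W I : Type) (f : W -> R -> R) N (L : nat)
    (j : I -> seq W) :
  (forall t, size (j t) = L) -> similarities f N ->
  similarities (fun t => comp_word f (j t)) (N ^+ L).
Proof. by move=> hj hf t x y; rewrite (comp_word_similar hf) hj. Qed.

(* A point set of separation rho r inside an interval of length 2 a r is
   injected into a finite index set whose size depends on a / rho only. *)
Lemma grid_index (a rho : R) : 0 < rho -> exists C : nat,
  forall r c : R, 0 < r -> exists idx : R -> 'I_C.+1, forall z z' : R,
    `|z - c| <= a * r -> `|z' - c| <= a * r -> idx z = idx z' ->
    `|z - z'| < rho * r.
Proof.
move=> rho0; exists (Num.truncn (2 * a / rho)) => r c r0.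
(* Cells of length [rho * r], counted from the left end [c - a * r]. *)
pose k z := Num.truncn ((z - c + a * r) / (rho * r)).
have rr0 : 0 < rho * r by rewrite mulr_gt0.
exists (fun z => inord (k z)) => z z' hz hz'.
have hk : forall y : R, `|y - c| <= a * r ->
    (k y < (Num.truncn (2 * a / rho)).+1)%N /\
    (k y)%:R * (rho * r) <= y - c + a * r < (k y).+1%:R * (rho * r).
  move=> y; rewrite ler_norml => /andP[h1 h2]; split.
    rewrite ltnS le_truncn // ler_pdivrMr //.
    have -> : 2 * a / rho * (rho * r) = 2 * (a * r) by field; rewrite gt_eqF.
    by lra.
  rewrite -ler_pdivlMr // -ltr_pdivrMr //; apply: truncn_itv.
  by apply: divr_ge0; [lra | exact: ltW].
have [k1 b1] := hk z hz; have [k2 b2] := hk z' hz'.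
move=> /(congr1 val) /=; rewrite !inordK // => e; move: b1 b2; rewrite e.
move=> /andP[b1 b2] /andP[b3 b4].
rewrite -natr1 mulrDl mul1r in b2 b4.
by rewrite ltr_norml; apply/andP; split; lra.
Qed.

End Similarities.

(** * Sums and counts over tuples, coordinate by coordinate *)

Lemma sum_tuple_prod (A : comPzSemiRingType) (T : finType) (n : nat)
    (F : 'I_n -> T -> A) :
  \sum_(t : n.-tuple T) \prod_i F i (tnth t i) = \prod_i \sum_x F i x.
Proof.
rewrite bigA_distr_bigA (reindex (@tuple_of_finfun T n)) /=; last first.
  by exists (@finfun_of_tuple T n) => t _;
    [exact: tuple_of_finfunK | exact: finfun_of_tupleK].
apply: eq_bigr => f _; apply: eq_bigr => i _.
by rewrite -[in RHS](tuple_of_finfunK f) ffunE.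
Qed.

Lemma card_tuple_all (T : finType) (n : nat) (P : 'I_n -> pred T) :
  #|[set t : n.-tuple T | [forall i, P i (tnth t i)]]%SET| = (\prod_i #|P i|)%N.
Proof.
rewrite -sum1_card.
transitivity (\sum_(t : n.-tuple T) \prod_i (P i (tnth t i) : nat))%N.
  rewrite big_mkcond /=; apply: eq_bigr => t _; rewrite inE.
  case: forallP => [h|/forallP]; first by rewrite big1 // => i _; rewrite h.
  rewrite negb_forall => /existsP[i /negbTE h].
  by rewrite (bigD1 i) //= h mul0n.
rewrite (sum_tuple_prod (fun i x => P i x : nat)); apply: eq_bigr => i _.
by rewrite -sum1_card [RHS]big_mkcond.
Qed.

(** * Words sharing a prefix and a longer weak prefix *)

Section PrefixCount.
Context (W H : finType) (tau : W -> H) (P : nat).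
Hypothesis fibre : forall h, #|[pred w | tau w == h]| = P.

Lemma card_uniform_fibres : #|W| = (#|H| * P)%N.
Proof.
rewrite -sum1_card (partition_big tau predT) //= -[in RHS]sum1_card big_distrl /=.
by apply: eq_bigr => h _; rewrite mul1n -(fibre h) -sum1_card.
Qed.

(** The letters below [l] are fixed, those from [l] to [q] range over a fibre of size [P], and the
    remaining [Q - q] are free. *)
Lemma card_prefix (Q q l : nat) (t0 : Q.-tuple W) : (l <= q <= Q)%N ->
  (#|[set t : Q.-tuple W | (take l t == take l t0) &&
       (map tau (take q t) == map tau (take q t0))]%SET|
   <= P ^ (q - l) * #|W| ^ (Q - q))%N.
Proof.
move=> /andP[hlq hqQ].
pose F (i : 'I_Q) : pred W := fun x =>
  if (i < l)%N then x == tnth t0 i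
  else if (i < q)%N then tau x == tau (tnth t0 i) else true.
apply: (@leq_trans #|[set t : Q.-tuple W | [forall i, F i (tnth t i)]]%SET|).
  apply/subset_leq_card/fintype.subsetP => t; rewrite !inE => /andP[/eqP h1 /eqP h2].
  apply/forallP => i; rewrite /F; have w0 : W := tnth t0 i.
  case: ltnP => il.
    have := congr1 (fun s => nth w0 s i) h1.
    by rewrite !nth_take // -!tnth_nth => ->.
  case: ltnP => // iq.
  have := congr1 (fun s => nth (tau w0) s i) h2.
  rewrite !(nth_map w0) ?size_takel ?size_tuple //.
  by rewrite !nth_take // -!tnth_nth => ->.
rewrite card_tuple_all.
pose G (i : nat) := if (i < l)%N then 1%N else if (i < q)%N then P else #|W|.
rewrite (eq_bigr (fun i : 'I_Q => G i)); last first.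
  move=> i _; rewrite /G /F; case: ltnP => _.
    by rewrite -(card1 (tnth t0 i)); apply: eq_card => x; rewrite !inE.
  case: ltnP => _; last by apply: eq_card => x; rewrite !inE.
  by rewrite -(fibre (tau (tnth t0 i))); apply: eq_card => x; rewrite !inE.
rewrite -(big_mkord predT G) (big_cat_nat (n := l)) ?(leq_trans hlq) //=.
rewrite (big_cat_nat (m := l) (n := q)) //=.
rewrite !big_nat.
rewrite big1 ?mul1n; last by move=> i /= hi; rewrite /G hi.
rewrite (eq_bigr (fun=> P)); last first.
  by move=> i /andP[h1 h2]; rewrite /G ltnNge h1 h2.
rewrite [X in (_ * X)%N](eq_bigr (fun=> #|W|)); last first.
  move=> i /andP[h1 _]; rewrite /G ltnNge (leq_trans hlq h1) /=.
  by rewrite ltnNge h1.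
by rewrite -!big_nat !prod_nat_const_nat.
Qed.

End PrefixCount.

(** * Words whose points lie in a given box *)

Section BoxCount.
Context {R : realType} (W H : finType) (tau : W -> H) (P : nat).
Context (fx : W -> R -> R) (fy : H -> R -> R) (N M B x0 y0 : R).
Hypothesis fibre : forall h, #|[pred w | tau w == h]| = P.
Hypothesis N0 : 0 < N.
Hypothesis M0 : 0 < M.
Hypothesis simx : similarities fx N.
Hypothesis simy : similarities fy M.
Hypothesis sepx : separated tau fx N.
Hypothesis sepy : separated (fun _ : H => tt) fy M.
Hypothesis bndx : forall u, `|comp_word fx u x0| <= B.
Hypothesis bndy : forall u, `|comp_word fy u y0| <= B.

(* A box of side M^-q ~ N^-l is met only by boundedly many approximate squares,
   each coded by q letters of H and, above the first l of them, by letters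
   of W. *)
Lemma card_words_in_box : exists C : nat, forall (q l Q : nat) (c1 c2 : R),
  (l <= q <= Q)%N -> N ^+ l <= M ^+ q ->
  (#|[set t : Q.-tuple W |
      (`|comp_word fx t x0 - c1| <= 3 / M ^+ q)%R
      && (`|comp_word fy (map tau t) y0 - c2| <= 3 / M ^+ q)%R]%SET|
   <= C * (P ^ (q - l) * #|W| ^ (Q - q)))%N.
Proof.
have [r1 [v1 [r10 sx]]] := sepx; have [r2 [v2 [r20 sy]]] := sepy.
have [C1 hC1] := @grid_index R (3 + (B + `|v1|)) r1 r10.
have [C2 hC2] := @grid_index R (3 + (B + `|v2|)) r2 r20.
exists (C1.+1 * C2.+1)%N => q l Q c1 c2 /andP[hlq hqQ] hNM.
have Nl0 : 0 < N ^+ l by rewrite exprn_gt0.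
have Mq0 : 0 < M ^+ q by rewrite exprn_gt0.
have [i1 hi1] := hC1 (N ^+ l)^-1 c1 ltac:(by rewrite invr_gt0).
have [i2 hi2] := hC2 (M ^+ q)^-1 c2 ltac:(by rewrite invr_gt0).
set G := [set t | _]%SET.
(* Grid cells of the base points reached by [l] letters horizontally and [q] letters vertically;
   each value of [phi] will admit a single prefix class. *)
pose phi (t : Q.-tuple W) : 'I_C1.+1 * 'I_C2.+1 :=
  (i1 (comp_word fx (take l t) v1), i2 (comp_word fy (take q (map tau t)) v2)).
(* Since the dropped tail sends [x] to a point of modulus at most [B], replacing that point by [v]
   costs at most (B + |v|) / S^j. *)
have split_close (X : Type) (f : X -> R -> R) (S : R) (j : nat) (u : seq X)
    (x v c : R) : 0 < S -> similarities f S -> (j <= size u)%N ->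
    (forall u, `|comp_word f u x| <= B) ->
    `|comp_word f u x - c| <= 3 / S ^+ j ->
    `|comp_word f (take j u) v - c| <= (3 + (B + `|v|)) / S ^+ j.
  move=> S0 sf ju bf; rewrite -{1}(cat_take_drop j u) comp_word_cat => hc.
  set z := comp_word f (drop j u) x in hc.
  have hz : `|comp_word f (take j u) v - comp_word f (take j u) z|
      <= (B + `|v|) / S ^+ j.
    rewrite (comp_word_similar sf) size_takel // ler_pM2r ?invr_gt0 ?exprn_gt0 //.
    by rewrite (le_trans (ler_normB _ _)) // addrC lerD2r bf.
  apply: (le_trans (ler_distD (comp_word f (take j u) z) _ _)).
  by rewrite [leRHS]mulrDl addrC lerD.
have phi_key t t' : t \in G -> t' \in G -> phi t = phi t' ->
    (take l t == take l t') && (map tau (take q t) == map tau (take q t')).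
  rewrite !inE => /andP[hx hy] /andP[hx' hy'] [e1 e2].
  have le3 : 3 / M ^+ q <= 3 / N ^+ l.
    by rewrite ler_pM2l // lef_pV2 ?posrE.
  (* The vertical prefix comes first, because horizontal separation applies only to words with equal
     [tau]-images. *)
  have ey : take q (map tau t) = take q (map tau t').
    have [//|/eqP ne] := eqVneq (take q (map tau t)) (take q (map tau t')).
    have : r2 / M ^+ q <= `|comp_word fy (take q (map tau t)) v2
                            - comp_word fy (take q (map tau t')) v2|.
      have := sy (take q (map tau t)) (take q (map tau t')).
      rewrite !size_takel ?size_map ?size_tuple // => /(_ erefl); apply => //.
      apply: (@eq_from_nth _ tt); first by rewrite !size_map !size_takel ?size_map ?size_tuple.
      by move=> i _; case: (nth _ _ _); case: (nth _ _ _).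
    rewrite leNgt hi2 //; apply: split_close => //;
      by rewrite size_map size_tuple.
  have ex : take l t = take l t'.
    have [//|/eqP ne] := eqVneq (take l t) (take l t').
    have : r1 / N ^+ l <= `|comp_word fx (take l t) v1
                            - comp_word fx (take l t') v1|.
      have := sx (take l t) (take l t').
      rewrite !size_takel ?size_tuple ?(leq_trans hlq) // => /(_ erefl).
      apply => //; rewrite !map_take.
      by have := congr1 (take l) ey; rewrite !take_takel.
    rewrite leNgt hi1 //; apply: split_close => //;
      rewrite ?size_tuple ?(leq_trans hlq) //; exact: le_trans le3.
  by rewrite ex eqxx !map_take ey eqxx.
rewrite -sum1_card (partition_big phi predT) //=.
have -> : (C1.+1 * C2.+1)%N = #|{: 'I_C1.+1 * 'I_C2.+1}|.
  by rewrite card_prod !card_ord.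
rewrite -sum_nat_const; apply: leq_sum => k _; rewrite sum1_card.
have [t0 /= ht0|no] := pickP [pred t | (t \in G) && (phi t == k)]; last first.
  by rewrite (eq_card (B := pred0)) ?card0.
have := @card_prefix _ _ _ _ fibre Q q l t0; rewrite hlq => /(_ hqQ) hc.
apply: leq_trans _ hc.
apply/subset_leq_card/fintype.subsetP => t /= ht; rewrite inE.
move: ht0 (ht : (t \in G) && (phi t == k)) => /andP[g0 /eqP p0] /andP[g /eqP p].
by apply: phi_key => //; rewrite p p0.
Qed.

End BoxCount.

(** * Diameters and covers for a null Hausdorff measure *)

Section HausdorffFacts.
Context {R : realType} (T : Type) (dist : T -> T -> R).

Lemma diam_pow_ge0 (s : R) (A : set T) : (0 <= diam_pow dist s A)%E.
Proof. by rewrite /diam_pow; case: ifP => // _; exact: poweR_ge0. Qed.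

Lemma diam_ge0 (A : set T) : (0 <= diam dist A)%E.
Proof. by apply: ereal_sup_ubound; left. Qed.

Lemma diam_powE (s delta : R) (A : set T) :
  A !=set0 -> (diam dist A <= delta%:E)%E ->
  exists r : R, [/\ 0 <= r <= delta, forall x y, A x -> A y -> dist x y <= r
    & diam_pow dist s A = (r `^ s)%:E].
Proof.
move=> /set0P A0 hd; have d0 := diam_ge0 A.
have dfin : diam dist A \is a fin_num.
  by rewrite ge0_fin_numE // (le_lt_trans hd) // ltry.
exists (fine (diam dist A)); split.
- by rewrite fine_ge0 // -lee_fin fineK.
- move=> x y Ax Ay; rewrite -lee_fin fineK //.
  by apply: ereal_sup_ubound; right; exists x => //; exists y.
- rewrite /diam_pow; case: asboolP => [h|_]; first by rewrite h eqxx in A0.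
  by rewrite -poweR_EFin fineK.
Qed.

Lemma hausdorff_null_cover (s delta e : R) (A : set T) :
  hausdorff_measure dist s A = 0%E -> 0 < delta -> 0 < e ->
  exists2 U, delta_cover dist delta A U &
    (\sum_(0 <= i <oo) diam_pow dist s (U i) <= e%:E)%E.
Proof.
move=> h0 d0 e0.
have : (hausdorff_premeasure dist s delta A < e%:E)%E.
  apply: (@le_lt_trans _ _ 0%E); last by rewrite lte_fin.
  by rewrite -h0; apply: ereal_sup_ubound; exists delta.
by move=> /ereal_inf_lt[_ [U hU <-]] /ltW ?; exists U.
Qed.

End HausdorffFacts.

(** * Scales of covering sets, and boxes in the plane *)

Lemma expr_inv_small {R : realType} (a e : R) : 1 < a -> 0 < e ->
  exists q : nat, (a ^+ q)^-1 <= e.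
Proof.
move=> a1 e0; have la : 0 < ln a by rewrite ln_gt0.
have a0 : 0 < a by lra.
exists (Num.truncn (e^-1 / ln a)).+1.
rewrite invf_ple ?posrE ?exprn_gt0 //.
rewrite -{1}(lnK (x := a)) ?posrE // -expRM_natl.
apply: le_trans (expR_ge1Dx _); rewrite -[leLHS](divfK (lt0r_neq0 la)).
have : e^-1 / ln a * ln a <= (Num.truncn (e^-1 / ln a)).+1%:R * ln a.
  by rewrite ler_pM2r // ltW // truncnS_gt.
by lra.
Qed.

(* The exponent q is the scale of a covering set of diameter r: M^-q is
   comparable with r, or negligible if r = 0. *)
Lemma covering_scale {R : realType} (M s t r e : R) :
  1 < M -> 0 <= s <= t -> 0 < t -> 0 <= r <= 1 -> 0 < e ->
  exists q : nat, r <= (M ^+ q)^-1 /\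
    ((M `^ t) ^+ q)^-1 <= M `^ t * r `^ s + e.
Proof.
move=> M1 /andP[s0 st] t0 /andP[r0 r1] e0; have M0 : 0 < M by lra.
have lM : 0 < ln M by rewrite ln_gt0.
have At1 : 1 < M `^ t.
  by rewrite /powR gt_eqF // expR_gt1 mulr_gt0.
have [re|rne] := eqVneq r 0.
  have [q hq] := expr_inv_small At1 e0.
  exists q; split; first by rewrite re invr_ge0 exprn_ge0 // ltW.
  by rewrite (le_trans hq) // lerDr mulr_ge0 // powR_ge0.
have rp : 0 < r by rewrite lt_def rne.
have lr : 0 <= - ln r by rewrite oppr_ge0 ln_le0.
(* Thus M^-(q+1) < r <= M^-q; the second bound then follows from r^t <= r^s, valid as [r <= 1] and
   [s <= t]. *)
pose q := Num.truncn (- ln r / ln M).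
have /andP[q1 q2] : q%:R <= - ln r / ln M < q.+1%:R.
  by apply: truncn_itv; rewrite divr_ge0 // ltW.
rewrite ler_pdivlMr // in q1; rewrite ltr_pdivrMr // in q2.
exists q; split.
  rewrite -[leLHS](lnK (x := r)) ?posrE // -{1}(lnK (x := M)) ?posrE //.
  by rewrite -expRM_natl -expRN ler_expR; lra.
rewrite (le_trans (y := M `^ t * r `^ s)) ?lerDl ?(ltW e0) //.
rewrite /powR !gt_eqF // -expRM_natl -expRN -expRD ler_expR.
rewrite -natr1 in q2.
have h1 : t * ln r <= s * ln r.
  by rewrite ler_wnM2r // -oppr_ge0.
have h2 : t * (- ln r) <= t * ((q%:R + 1) * ln M) by rewrite ler_pM2l // ltW.
by lra.
Qed.

Lemma prod_ballP {R : realType} (c p : R * R) (r : R) :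
  ball c r p <-> `|p.1 - c.1| < r /\ `|p.2 - c.2| < r.
Proof.
rewrite prod_norm_ball /ball_ /= prod_normE gt_max /= (distrC c.1) (distrC c.2).
by split=> /andP.
Qed.

Lemma plane_dist_ge {R : realType} (p q : R * R) :
  `|p.1 - q.1| <= plane_dist p q /\ `|p.2 - q.2| <= plane_dist p q.
Proof.
by rewrite /plane_dist -!sqrtr_sqr; split; rewrite ler_wsqrtr //;
  rewrite ?lerDl ?lerDr sqr_ge0.
Qed.

Lemma compact_plane_bounded {R : realType} (K : set (R * R)) : compact K ->
  exists B, forall p, K p -> `|p.1| <= B /\ `|p.2| <= B.
Proof.
move=> /compact_bounded[B [_ hB]]; exists (B + 1) => p Kp.
have := hB (B + 1) (ltac:(by rewrite ltrDl)) p Kp.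
by rewrite /= prod_normE ge_max => /andP.
Qed.

Lemma card_le_sum_cover (T : finType) (n : nat) (G : 'I_n -> {set T}) :
  (forall t, exists i, t \in G i) -> (#|T| <= \sum_i #|G i|)%N.
Proof.
move=> h; rewrite -sum1_card (eq_bigr (fun i => \sum_t (t \in G i))%N); last first.
  by move=> i _; rewrite -sum1_card big_mkcond.
rewrite exchange_big /=; apply: leq_sum => t _.
by have [i hi] := h t; rewrite (bigD1 i) //= hi leq_addr.
Qed.

(** * Lower bound when all fibres have the same size *)

Section UniformLower.
Context {R : realType} (W H : finType) (tau : W -> H) (P : nat).
Context (fx : W -> R -> R) (fy : H -> R -> R) (N M b : R).
Context (K : set (R * R)) (x0 y0 : R).
Hypothesis fibre : forall h, #|[pred w | tau w == h]| = P.
Hypothesis P0 : (0 < P)%N.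
Hypothesis H0 : (0 < #|H|)%N.
Hypothesis N1 : 1 < N.
Hypothesis M1 : 1 < M.
Hypothesis b01 : 0 < b <= 1.
Hypothesis NbM : N `^ b = M.
Hypothesis simx : similarities fx N.
Hypothesis simy : similarities fy M.
Hypothesis sepx : separated tau fx N.
Hypothesis sepy : separated (fun _ : H => tt) fy M.
Hypothesis cK : compact K.
Hypothesis KS : forall u, K (comp_word fx u x0, comp_word fy (map tau u) y0).

(* Each cover is refined to finitely many boxes, and the words of a large common
   length Q are counted by the boxes containing the points they code. *)
Lemma uniform_lower (s : R) : 0 <= s ->
  s * ln M < ln #|H|%:R + b * ln P%:R ->
  hausdorff_measure (@plane_dist R) s K <> 0%E.
Proof.
move=> s0 hs hK0.
have /andP[b0 b1] := b01.
have lM : 0 < ln M by rewrite ln_gt0.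
have M0 : 0 < M := lt_trans ltr01 M1.
have N0 : 0 < N := lt_trans ltr01 N1.
have P1 : 1 <= P%:R :> R by rewrite ler1n.
have Pp : 0 < P%:R :> R := lt_le_trans ltr01 P1.
have T1 : 0 < #|H|%:R :> R by rewrite ltr0n.
(* The expected dimension of the uniform system; [A], which is M^t, equals #|H| P^b. *)
pose t := (ln #|H|%:R + b * ln P%:R) / ln M.
pose A := M `^ t.
have tM : t * ln M = ln #|H|%:R + b * ln P%:R by rewrite divfK // gt_eqF.
have hA : A = #|H|%:R * P%:R `^ b.
  rewrite /A /powR !gt_eqF // tM expRD; congr (_ * _); by rewrite lnK.
have st : s <= t by rewrite -(ler_pM2r lM) tM ltW.
have sst : 0 <= s <= t by rewrite s0.
have t0 : 0 < t by apply: (le_lt_trans s0); rewrite -(ltr_pM2r lM) tM.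
have A0 : 0 < A by rewrite powR_gt0.
have [B hB] := compact_plane_bounded cK.
have sec h : exists w, tau w = h.
  have : (0 < #|[pred w | tau w == h]|)%N by rewrite fibre.
  by case/card_gt0P => w /eqP; exists w.
(* A section of [tau] lifts every word over [H] to one over [W], so the bound on [K] also bounds all
   vertical images. *)
have [g hg] := choice sec.
have bndx u : `|comp_word fx u x0| <= B by have [] := hB _ (KS u).
have bndy u : `|comp_word fy u y0| <= B.
  have [_] := hB _ (KS (map g u)).
  by rewrite -map_comp (eq_map (g := id)) ?map_id // => h /=.
have [C hC] := card_words_in_box fibre N0 M0 simx simy sepx sepy bndx bndy.
(* The final count will read [1 <= (D - 1) * e], which is impossible as [D * e] is 1/2. *)
pose D : R := C%:R * P%:R * (A + 1) + 1; pose e := (2 * D)^-1.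
have D0 : 0 < D.
  by rewrite ltr_wpDl // !mulr_ge0 // addr_ge0 // ltW.
have e0 : 0 < e by rewrite invr_gt0 mulr_gt0.
have [U [KU hU] sumU] := hausdorff_null_cover hK0 ltr01 e0.
pose w i : R := fine (diam_pow (@plane_dist R) s (U i)).
have w0 i : 0 <= w i by rewrite fine_ge0 // diam_pow_ge0.
have hscale i : exists qc : nat * (R * R),
    (forall p, U i p -> `|p.1 - qc.2.1| <= (M ^+ qc.1)^-1
                     /\ `|p.2 - qc.2.2| <= (M ^+ qc.1)^-1)
    /\ diam_pow (@plane_dist R) s (U i) = (w i)%:E
    /\ (A ^+ qc.1)^-1 <= A * w i + e / 2 ^+ i.+1.
  have ei : 0 < e / 2 ^+ i.+1 by rewrite divr_gt0 // exprn_gt0.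
  have [U0|/set0P[p Up]] := eqVneq (U i) set0.
    (* The positive exponent [t] replaces [s]: for [s = 0] the power of 0 would be 1, whereas the
       empty set has weight 0. *)
    have [q [_ hq]] := @covering_scale R M t t 0 _ M1 ltac:(by rewrite lexx ltW)
      t0 ltac:(by rewrite lexx ler01) ei.
    exists (q, (0, 0)); split; first by move=> p; rewrite U0.
    rewrite /w /diam_pow; case: asboolP => // _; split=> //=.
    by move: hq; rewrite powR0 ?gt_eqF.
  have [r [r01 hr hw]] := @diam_powE R _ _ s _ _ (ex_intro _ p Up) (hU i).
  have [q [h1 h2]] := covering_scale M1 sst t0 r01 ei.
  exists (q, p); split=> /=.
    move=> p' Up'; have [d1 d2] := plane_dist_ge p' p; have d3 := hr _ _ Up' Up.
    by split; lra.
  by rewrite /w hw.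
have [f hf] := choice hscale.
pose q i := (f i).1; pose c i := (f i).2.
(* Open balls of doubled radius contain the covering sets, so compactness leaves finitely many of
   them. *)
pose V i := ball (c i) (2 / M ^+ q i) : set (R * R).
have Mq i : 0 < (M ^+ q i)^-1 by rewrite invr_gt0 exprn_gt0.
have KV : K `<=` cover setT V.
  move=> p /KU[i _ /(proj1 (hf i))[h1 h2]]; exists i => //.
  by apply/prod_ballP; rewrite -/(q i) in h1 h2; have := Mq i; split; lra.
have : cover_compact K.
  by move: (cK); rewrite (compact_cover ((R * R)%type : normedModType R)).
move=> /(_ nat setT V (fun i _ => ball_open _ _) KV)[E _ KE].
pose n := (\max_(i <- finmap.enum_fset E) i).+1.
have Kn p : K p -> exists i : 'I_n, V i p.
  move=> /KE[i /= iE Vp].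
  have lin : (i < n)%N by rewrite ltnS; apply: (@leq_bigmax_seq _ _ xpredT id).
  by exists (Ordinal lin).
(* Rounding down gives N^l <= M^q, and the two scales agree up to a factor [N]. *)
pose l i := Num.truncn (b * (q i)%:R).
have hl i : (l i)%:R <= b * (q i)%:R < (l i).+1%:R.
  by apply: truncn_itv; rewrite mulr_ge0 // ltW.
have llq i : (l i <= q i)%N.
  have /andP[h _] := hl i; rewrite -(ler_nat R) (le_trans h) // ler_piMl //.
have NM i : N ^+ l i <= M ^+ q i.
  rewrite -!powR_mulrn ?(ltW N0) ?(ltW M0) // -NbM -powRrM; apply: ler_powR; first exact: ltW.
  by have /andP[] := hl i.
pose Q := (\max_(i < n) q i)%N.
have count : (#|W| ^ Q <=
    \sum_(i < n) C * (P ^ (q i - l i) * #|W| ^ (Q - q i)))%N.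
  rewrite -card_tuple; apply: leq_trans
    (@card_le_sum_cover _ n (fun i => [set t : Q.-tuple W |
      (`|comp_word fx t x0 - (c i).1| <= 3 / M ^+ q i)%R
      && (`|comp_word fy (map tau t) y0 - (c i).2| <= 3 / M ^+ q i)%R]%SET) _) _.
    move=> u; have [i /prod_ballP[/= h1 h2]] := Kn _ (KS u); exists i; rewrite inE.
    by have mq := Mq i; apply/andP; split; lra.
  apply: leq_sum => i _; apply: hC => //; rewrite llq /=.
  exact: (@leq_bigmax _ (fun i : 'I_n => q i)).
have cW := card_uniform_fibres fibre.
have Wp : 0 < #|W|%:R :> R by rewrite cW natrM mulr_gt0.
(* Inserting #|W| = #|H| P and A = #|H| P^b reduces this to b q <= l + 1; the extra factor [P] pays
   for the rounding of [l]. *)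
have term i : (i < n)%N ->
    (P ^ (q i - l i) * #|W| ^ (Q - q i))%:R <=
      P%:R * (A ^+ q i)^-1 * #|W|%:R ^+ Q :> R.
  move=> lin; have qQ : (q i <= Q)%N.
    exact: (@leq_bigmax _ (fun i : 'I_n => q i) (Ordinal lin)).
  have key : P%:R ^+ (q i - l i) * A ^+ q i <= P%:R * #|W|%:R ^+ q i.
    rewrite cW natrM hA !exprMn mulrCA [leRHS]mulrCA ler_pM2l ?exprn_gt0 //.
    rewrite -exprS.
    have -> : (q i).+1 = ((q i - l i) + (l i).+1)%N by rewrite addnS subnK.
    rewrite exprD ler_pM2l ?exprn_gt0 // -!powR_mulrn ?powR_ge0 // -powRrM.
    by apply: ler_powR => //; apply: ltW; have /andP[] := hl i.
  rewrite -ler_pdivlMr ?exprn_gt0 // in key.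
  rewrite natrM !natrX -(subnK qQ) exprD addnK.
  have -> : P%:R / A ^+ q i * (#|W|%:R ^+ (Q - q i) * #|W|%:R ^+ q i) =
      P%:R * #|W|%:R ^+ q i / A ^+ q i * #|W|%:R ^+ (Q - q i) by ring.
  by rewrite ler_pM2r // exprn_gt0.
have big1 : 1 <= C%:R * P%:R * \sum_(i < n) (A ^+ q i)^-1.
  have h : #|W|%:R ^+ Q <=
      (C%:R * P%:R * \sum_(i < n) (A ^+ q i)^-1) * #|W|%:R ^+ Q :> R.
    rewrite -natrX; apply: (@le_trans _ _ (\sum_(i < n)
      C * (P ^ (q i - l i) * #|W| ^ (Q - q i)))%:R); first by rewrite ler_nat.
    rewrite natr_sum mulr_sumr mulr_suml; apply: ler_sum => i _.
    rewrite natrM -!mulrA; apply: ler_wpM2l => //; rewrite mulrA.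
    rewrite natrX; exact: (term i (ltn_ord i)).
  by rewrite -(ler_pM2r (exprn_gt0 Q Wp)) mul1r.
have sum1 : \sum_(i < n) w i <= e.
  rewrite -lee_fin -sumEFin; apply: le_trans sumU.
  rewrite (eq_bigr (fun i : 'I_n => diam_pow (@plane_dist R) s (U i))); last first.
    by move=> i _; have [_ [->]] := hf i.
  rewrite -(big_mkord predT (fun i => diam_pow (@plane_dist R) s (U i))).
  by apply: nneseries_lim_ge => i _ _; exact: diam_pow_ge0.
have sum2 j : \sum_(i < j) e / 2 ^+ i.+1 = e - e / 2 ^+ j.
  elim: j => [|j IH]; first by rewrite big_ord0 expr0; lra.
  by rewrite big_ord_recr /= IH exprS invfM; field; rewrite expf_neq0.
have sum3 : \sum_(i < n) (A ^+ q i)^-1 <= (A + 1) * e.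
  apply: (@le_trans _ _ (\sum_(i < n) (A * w i + e / 2 ^+ i.+1))).
    by apply: ler_sum => i _; have [_ []] := hf i.
  rewrite big_split /= -mulr_sumr sum2 mulrDl mul1r lerD //.
    by rewrite ler_pM2l.
  by rewrite gerBl divr_ge0 ?exprn_ge0 // ltW.
have : 1 <= (D - 1) * e.
  rewrite addrK -mulrA; apply: le_trans big1 _.
  by apply: ler_wpM2l => //; rewrite mulr_ge0.
have De : D * e = 2^-1 by rewrite /e; field; rewrite gt_eqF.
by lra.
Qed.

End UniformLower.

(** * Polynomial growth and the types of words *)

Lemma log_sublinear {R : realType} (a d : R) : 0 <= a -> 0 < d ->
  exists2 L : nat, (0 < L)%N & a * ln L.+1%:R < d * L%:R.
Proof.
move=> a0 d0; pose t := (Num.truncn (2 * a / d)).+1.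
have ht : 2 * a < d * t%:R by rewrite [ltRHS]mulrC -ltr_pdivrMr // truncnS_gt.
have t0 : 0 < t%:R :> R by rewrite ltr0n.
(* With this choice L + 1 is the square (1 + t)^2, so ln (L + 1) <= 2 t while L >= t^2. *)
exists (t * (t + 2))%N; first by rewrite muln_gt0 addnS.
have -> : (t * (t + 2)).+1 = ((1 + t) ^ 2)%N by rewrite expnS expn1; lia.
have lt : ln (1 + t%:R) <= t%:R :> R.
  by apply: le_ln1Dx; apply: lt_trans t0; rewrite ltrN10.
rewrite natrX natrD lnXn; last by rewrite ltr_wpDl.
have := ler_wpM2l a0 lt; rewrite natrM natrD mulr2n.
by have := mulr_gt0 d0 t0; nra.
Qed.

Lemma exprn_powR {R : realType} (a b : R) (L : nat) : 0 <= a ->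
  (a ^+ L) `^ b = (a `^ b) ^+ L.
Proof.
move=> a0; rewrite -(powR_mulrn L a0) -powRrM mulrC powRrM.
by rewrite powR_mulrn // powR_ge0.
Qed.

Section WordTypes.
Context (R : realType) (H : finType) (L : nat).

(** The bounded codomain makes the number of types at most (L + 1)^#|H|; [inord] is exact because a
    letter occurs at most [L] times. *)
Definition word_type (h : L.-tuple H) : {ffun H -> 'I_L.+1} :=
  [ffun x => inord (count_mem x h)].

Lemma word_type_perm (h h' : L.-tuple H) :
  word_type h = word_type h' -> perm_eq h h'.
Proof.
move=> /ffunP e; rewrite /perm_eq; apply/allP => x _; apply/eqP.
have := congr1 (@nat_of_ord _) (e x); rewrite !ffunE !inordK // ltnS.
  by rewrite (leq_trans (count_size _ _)) ?size_tuple.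
by rewrite (leq_trans (count_size _ _)) ?size_tuple.
Qed.

Lemma big_word_type (A : comPzSemiRingType) (F : H -> A) (h h' : L.-tuple H) :
  word_type h = word_type h' ->
  \prod_i F (tnth h i) = \prod_i F (tnth h' i).
Proof.
move=> /word_type_perm p; rewrite -!(big_tuple _ _ _ predT F).
exact: perm_big.
Qed.

(* There are only polynomially many types, so one of them carries almost the
   whole sum. *)
Lemma heavy_word_type (F : H -> R) : (forall x, 0 < F x) -> (0 < #|H|)%N ->
  exists h0 : L.-tuple H,
    (\sum_x F x) ^+ L <= L.+1%:R ^+ #|H| *
      (#|[pred h | word_type h == word_type h0]|%:R * \prod_i F (tnth h0 i)).
Proof.
move=> F0 H0; set Z := \sum_x F x.
have [x0 _] : exists x0 : H, true by case/card_gt0P: H0 => x _; exists x.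
have ZL : Z ^+ L = \sum_(h : L.-tuple H) \prod_i F (tnth h i).
  by rewrite (sum_tuple_prod (fun _ x => F x)) prodr_const card_ord.
pose S c := \sum_(h | word_type h == c) \prod_i F (tnth h i).
pose c := [arg max_(c > word_type [tuple of nseq L x0]) S c]%O.
have cmax c' : S c' <= S c.
  by rewrite /c; case: Order.TotalTheory.arg_maxP => // i _; exact.
have Zle : Z ^+ L <= L.+1%:R ^+ #|H| * S c.
  rewrite ZL (partition_big word_type predT) //=.
  apply: (@le_trans _ _ (\sum_(c' : {ffun H -> 'I_L.+1}) S c)).
    by apply: ler_sum => c' _; exact: cmax.
  by rewrite sumr_const card_ffun card_ord -natrX mulr_natl.
have Z0 : 0 < Z.
  rewrite /Z (bigD1 x0) //= ltr_pwDl // sumr_ge0 // => i _; exact: ltW.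
(* The heaviest class has a member, since an empty class would force Z^L <= 0. *)
have [h0 /= /eqP hc|no] := pickP [pred h | word_type h == c]; last first.
  have : 0 < Z ^+ L by rewrite exprn_gt0.
  rewrite ltNge => /negP[]; apply: le_trans Zle _.
  by rewrite /S big_pred0 ?mulr0.
exists h0; rewrite hc; apply: le_trans Zle _.
rewrite /S (eq_bigr (fun=> \prod_i F (tnth h0 i))); last first.
  by move=> h /eqP e; apply: big_word_type; rewrite e.
by rewrite sumr_const mulr_natl.
Qed.

End WordTypes.

(** * Lower bound for arbitrary multiplicities *)

Section GeneralLower.
Context {R : realType} (W H : finType) (tau : W -> H).
Context (fx : W -> R -> R) (fy : H -> R -> R) (N M b : R).
Context (K : set (R * R)) (x0 y0 : R).
Let mult h := #|[pred w | tau w == h]|.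
Hypothesis mult_gt0 : forall h, (0 < mult h)%N.
Hypothesis H0 : (0 < #|H|)%N.
Hypothesis N1 : 1 < N.
Hypothesis M1 : 1 < M.
Hypothesis b01 : 0 < b <= 1.
Hypothesis NbM : N `^ b = M.
Hypothesis simx : similarities fx N.
Hypothesis simy : similarities fy M.
Hypothesis sepx : separated tau fx N.
Hypothesis sepy : separated (fun _ : H => tt) fy M.
Hypothesis cK : compact K.
Hypothesis KS : forall u, K (comp_word fx u x0, comp_word fy (map tau u) y0).

(* Keeping only the words of length L of a fixed type makes all fibres
   equally large. *)
Lemma block_lower (s : R) (L : nat) (h0 : L.-tuple H) : (0 < L)%N -> 0 <= s ->
  s * (ln M *+ L) < ln #|[pred h | word_type h == word_type h0]|%:R
    + b * ln (\prod_i mult (tnth h0 i))%:R ->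
  hausdorff_measure (@plane_dist R) s K <> 0%E.
Proof.
move=> L0 s0 hs.
(* [J] is the new alphabet of weak letters, the words of the fixed type, and [I] consists of the
   words over [W] above them. *)
pose J := {h : L.-tuple H | word_type h == word_type h0}.
pose I := {t : L.-tuple W | word_type (map_tuple tau t) == word_type h0}.
pose tau' (t : I) : J := exist _ (map_tuple tau (val t)) (valP t).
pose jx (t : I) : seq W := val (val t); pose jy (h : J) : seq H := val (val h).
have sjx t : size (jx t) = L by rewrite size_tuple.
have sjy t : size (jy t) = L by rewrite size_tuple.
have ijx : injective jx by move=> t t' /val_inj/val_inj.
have ijy : injective jy by move=> t t' /val_inj/val_inj.
have cJ : #|{: J}| = #|[pred h | word_type h == word_type h0]|.
  by rewrite card_sig.
have N0 : 0 < N := lt_trans ltr01 N1.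
have M0 : 0 < M := lt_trans ltr01 M1.
have pow x : 1 < x -> 1 < x ^+ L by move=> x1; rewrite expr_gt1 // ltW // (lt_trans ltr01).
apply: (@uniform_lower R I J tau' (\prod_i mult (tnth h0 i))%N
  (fun t => comp_word fx (jx t)) (fun h => comp_word fy (jy h))
  (N ^+ L) (M ^+ L) b K x0 y0) => //.
(* The fibre over a word of [J] is the product of the fibres of its letters, and the size of that
   product depends on the type alone. *)
- move=> h; have -> : (\prod_i mult (tnth h0 i) =
      \prod_i mult (tnth (val h) i))%N.
    by apply: (big_word_type mult); rewrite (eqP (valP h)).
  rewrite -(card_tuple_all (fun i => [pred w | tau w == tnth (val h) i])).
  rewrite -(fintype.card_image (@val_inj _ _ I)).
  apply: eq_card => t; rewrite inE; apply/fintype.imageP/forallP.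
    by move=> [t' /eqP e ->] i /=; rewrite -e /= tnth_map.
  move=> ht; have e : map_tuple tau t = val h.
    by apply: eq_from_tnth => i; rewrite tnth_map (eqP (ht i)).
  have et : word_type (map_tuple tau t) == word_type h0.
    by rewrite e; exact: valP h.
  by exists (exist _ t et) => //; apply/eqP/val_inj.
- by rewrite prodn_gt0.
- by rewrite cJ; apply/card_gt0P; exists h0; rewrite inE.
- exact: pow.
- exact: pow.
- by rewrite exprn_powR ?NbM // ltW.
- exact: similarities_blocks.
- exact: similarities_blocks.
- exact: (separated_blocks (p := jy) sjx ijx).
- apply: (separated_blocks (p := fun=> nseq L tt) sjy ijy _ sepy) => t.
  apply: (@eq_from_nth _ tt); first by rewrite size_map sjy size_nseq.
  by move=> i _; case: (nth _ _ _); case: (nth _ _ _).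
- move=> u; rewrite !comp_word_flatten.
  have -> : flatten (map jy (map tau' u)) = map tau (flatten (map jx u)).
    by elim: u => //= t u ->; rewrite map_cat.
  exact: KS.
- by rewrite lnXn // cJ.
Qed.

(** The number of types costs at most #|H| ln (L + 1), which for a suitable [L] is below the gain L
    (ln Z - s ln M). Taking logarithms in the bound for the heavy type then gives the hypothesis of
    [block_lower]. *)
Lemma general_lower (s : R) : 0 <= s ->
  s * ln M < ln (\sum_h (mult h)%:R `^ b) ->
  hausdorff_measure (@plane_dist R) s K <> 0%E.
Proof.
set Z := \sum_h _ => s0 hs.
have [L L0 hL] := @log_sublinear R #|H|%:R (ln Z - s * ln M) ltac:(by [])
  ltac:(by rewrite subr_gt0).
have F0 h : 0 < (mult h)%:R `^ b :> R by rewrite powR_gt0 // ltr0n.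
have [h0 hh0] := heavy_word_type L F0 H0.
apply: (@block_lower s L h0) => //.
set T := #|_|; set P := (\prod_i _)%N.
have T0 : 0 < T%:R :> R by rewrite ltr0n; apply/card_gt0P; exists h0; rewrite inE.
have P0 : 0 < P%:R :> R by rewrite ltr0n prodn_gt0.
have PE : \prod_i (mult (tnth h0 i))%:R `^ b = P%:R `^ b :> R.
  apply: (big_ind2 (fun (x : R) (y : nat) => x = y%:R `^ b)) => //.
    by rewrite powR1.
  by move=> x x' y y' -> ->; rewrite natrM powRM.
have Z0 : 0 < Z.
  case/card_gt0P: (H0) => x _; rewrite /Z (bigD1 x) //= ltr_pwDl //.
  by rewrite sumr_ge0 // => i _; exact: ltW.
have := hh0; rewrite -/Z -/T PE -ler_ln ?posrE ?exprn_gt0 //; last first.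
  by rewrite !mulr_gt0 ?powR_gt0 ?exprn_gt0.
rewrite !lnM ?posrE ?mulr_gt0 ?powR_gt0 ?exprn_gt0 // ln_powR !lnXn //.
rewrite -(mulr_natr (ln M)) -(mulr_natr (ln Z)) -(mulr_natr (ln L.+1%:R)) => h.
have -> : s * (ln M * L%:R) = ln Z * L%:R - (ln Z - s * ln M) * L%:R by ring.
by rewrite ltrBlDr (le_lt_trans h) // addrC ltrD2l mulrC.
Qed.

End GeneralLower.

(** * Upper estimates for Hausdorff measure, and McMullen's averaging argument *)

Section HausdorffUpper.
Context {R : realType} (T : Type) (dist : T -> T -> R).

Lemma diam_le (r : R) (A : set T) : 0 <= r ->
  (forall x y, A x -> A y -> dist x y <= r) -> (diam dist A <= r%:E)%E.
Proof.
move=> r0 h; apply: ge_ereal_sup => _ [->|[x Ax [y Ay <-]]]; rewrite lee_fin //.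
exact: h.
Qed.

Lemma diam_pow_le (s r : R) (A : set T) : 0 <= s -> 0 <= r ->
  (diam dist A <= r%:E)%E -> (diam_pow dist s A <= (r `^ s)%:E)%E.
Proof.
move=> s0 r0 h; rewrite /diam_pow; case: ifP => _.
  by rewrite lee_fin powR_ge0.
rewrite -poweR_EFin; apply: gt0_ler_poweR => //;
  by rewrite in_itv /= leey andbT ?diam_ge0 ?lee_fin.
Qed.

(** Codes are turned into positions of a sequence; positions that code nothing receive the empty
    set, of weight 0 even for [s = 0]. A bound on all finite sums of [g] then bounds the series. *)
Lemma premeasure_countable_cover (C : countType) (U : C -> set T) (g : C -> R)
    (s delta e : R) (A : set T) : 0 <= delta ->
  A `<=` \bigcup_c U c -> (forall c, (diam dist (U c) <= delta%:E)%E) ->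
  (forall c, (diam_pow dist s (U c) <= (g c)%:E)%E) ->
  (forall cs : seq C, uniq cs -> \sum_(c <- cs) g c <= e) ->
  (hausdorff_premeasure dist s delta A <= e%:E)%E.
Proof.
move=> d0 AU dU gU he.
pose V i := if @pickle_inv C i is Some c then U c else set0.
apply: (@le_trans _ _ (\sum_(0 <= i <oo) diam_pow dist s (V i))%E).
  apply: ereal_inf_lbound; exists V => //; split.
    move=> x /AU[c _ Uc]; exists (pickle c) => //.
    by rewrite /V pickleK_inv.
  move=> i; rewrite /V; case: pickle_inv => // .
  by apply: diam_le => // x y [].
apply: lime_le.
  by apply: is_cvg_nneseries => i _ _; exact: diam_pow_ge0.
near=> n.
apply: (@le_trans _ _ (\sum_(c <- pmap (@pickle_inv C) (iota 0 n)) (g c)%:E)%E).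
  rewrite /index_iota subn0; elim: (iota 0 n) => [|i r IH] /=; first by rewrite !big_nil.
  rewrite big_cons {1}/V; case: (pickle_inv i) => [c|] /=.
    by rewrite big_cons leeD.
  by rewrite /diam_pow; case: asboolP => // _; rewrite add0e.
rewrite sumEFin lee_fin; apply: he.
by apply: (pmap_uniq (@pickle_invK C)); exact: iota_uniq.
Unshelve. all: by end_near.
Qed.

Lemma hausdorff_null (s : R) (A : set T) :
  (forall delta e : R, 0 < delta -> 0 < e ->
     (hausdorff_premeasure dist s delta A <= e%:E)%E) ->
  hausdorff_measure dist s A = 0%E.
Proof.
move=> h; apply/eqP; rewrite eq_le; apply/andP; split.
  apply: ge_ereal_sup => _ [d /= d0 <-]; apply/lee_addgt0Pr => e e0.
  by rewrite add0e; exact: h.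
apply: le_ereal_sup_tmp; exists (hausdorff_premeasure dist s 1 A).
  by exists 1 => //=.
apply: le_ereal_inf_tmp => _ [U _ <-]; apply: nneseries_ge0 => i _ _.
exact: diam_pow_ge0.
Qed.

End HausdorffUpper.

(* McMullen's argument: were the inequality false for all q >= q0, the averages
   S q / q would decrease by e along each step of a sequence with
   floor (b * q_(j+1)) = q_j, hence become negative. *)
Lemma mcmullen_limsup {R : realType} (b e : R) (S : nat -> R) (q0 : nat) :
  0 < b < 1 -> 0 < e -> (forall q, 0 <= S q) ->
  exists2 q, (q0 <= q)%N & S (Num.truncn (b * q%:R)) <= b * S q + e * q%:R.
Proof.
move=> /andP[b0 b1] e0 S0; apply: contrapT => no.
have big q : (q0 <= q)%N -> b * S q + e * q%:R < S (Num.truncn (b * q%:R)).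
  by move=> hq; rewrite ltNge; apply/negP => h; apply: no; exists q.
pose f q : R := S q / q%:R.
have step j : exists2 q, (q0.+1 <= q)%N & f q <= f q0.+1 - e * j%:R.
  elim: j => [|j [q hq fq]]; first by exists q0.+1; rewrite // mulr0 subr0.
  have q1 : 0 < q%:R :> R by rewrite ltr0n; apply: leq_trans hq.
  (* This [q'] satisfies q < b q' < q + 1, the upper bound because [b < 1], so [q] is the rounding
     of b q'. *)
  pose q' := (Num.truncn (q%:R / b)).+1.
  have /andP[h1 h2] : (Num.truncn (q%:R / b))%:R <= q%:R / b < q'%:R.
    by apply: truncn_itv; rewrite divr_ge0 // ltW.
  have bq1 : q%:R < b * q'%:R by rewrite mulrC -ltr_pdivrMr.
  have bq2 : b * q'%:R < q%:R + 1.
    have : b * (Num.truncn (q%:R / b))%:R <= q%:R.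
      by rewrite mulrC -ler_pdivlMr.
    by rewrite /q' -natr1; lra.
  have q'0 : 0 < q'%:R :> R by rewrite ltr0n.
  have qq' : q%:R < q'%:R :> R by apply: lt_trans bq1 _; rewrite gtr_pMl.
  have lq' : Num.truncn (b * q'%:R) = q.
    by apply/eqP; rewrite truncn_eq ?mulr_ge0 ?(ltW b0) // (ltW bq1) -natr1 bq2.
  have q0q' : (q0.+1 <= q')%N by rewrite (leq_trans hq) // ltnW // -(ltr_nat R).
  exists q' => //; have := big q' (ltnW q0q'); rewrite lq' => h.
  apply: (@le_trans _ _ (f q - e)); last by rewrite -natr1; lra.
  rewrite /f ler_pdivrMr // mulrBl -(ler_pM2r q1).
  have -> : (S q / q%:R * q'%:R - e * q'%:R) * q%:R =
      S q * q'%:R - e * q'%:R * q%:R by field; rewrite gt_eqF.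
  have a1 : (b * S q' + e * q'%:R) * q'%:R <= S q * q'%:R.
    by rewrite ler_pM2r // ltW.
  have a2 : S q' * q%:R <= S q' * (b * q'%:R) by apply: ler_wpM2l; rewrite ?S0 ?ltW.
  have a3 : e * q'%:R * q%:R <= e * q'%:R * q'%:R.
    by apply: ler_wpM2l; rewrite ?mulr_ge0 ?ltW.
  by lra.
pose j := (Num.truncn (f q0.+1 / e)).+1.
have [q hq fq] := step j.
have : f q0.+1 < j%:R * e by rewrite -ltr_pdivrMr // truncnS_gt.
have : 0 <= f q by rewrite divr_ge0.
by lra.
Qed.

(** * Infinite codes of points, and sums over finite lists of boxes *)

(** Choice fixes a letter and a preimage for every point of [K]; iterating it gives one infinite
    sequence whose prefixes of every length code [p]. *)
Lemma coding {R : realType} (W H : Type) (tau : W -> H) (fx : W -> R -> R)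
    (fy : H -> R -> R) (K : set (R * R)) :
  (forall p, K p -> exists w p', K p' /\ p = (fx w p'.1, fy (tau w) p'.2)) ->
  forall p, K p -> exists om : nat -> W, forall q, exists2 p', K p' &
    p.1 = comp_word fx (mkseq om q) p'.1 /\
    p.2 = comp_word fy (map tau (mkseq om q)) p'.2.
Proof.
move=> hK p Kp.
have step (x : {p | K p}) : exists y : W * {p | K p},
    sval x = (fx y.1 (sval y.2).1, fy (tau y.1) (sval y.2).2).
  case: x => x Kx; have [w [x' [Kx' e]]] := hK x Kx.
  by exists (w, exist _ x' Kx').
have [f hf] := choice step.
pose pt i := iter i (fun x => (f x).2) (exist _ p Kp).
exists (fun i => (f (pt i)).1) => q; exists (sval (pt q)); first exact: svalP (pt q).
elim: q => [|q [IH1 IH2]] //.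
rewrite mkseqS map_rcons -!cats1 !comp_word_cat IH1 IH2 /=.
by have e := hf (pt q); rewrite e.
Qed.

Lemma sum_uniq_le {R : realType} (C : eqType) (T : finType) (v : T -> C)
    (P : pred C) (F : C -> R) (cs : seq C) :
  uniq cs -> (forall c, 0 <= F c) -> (forall c, P c -> exists t, v t = c) ->
  \sum_(c <- cs | P c) F c <= \sum_t F (v t).
Proof.
move=> ucs F0 hv.
apply: (@le_trans _ _ (\sum_(c <- cs | P c) \sum_(t | v t == c) F (v t))).
  apply: ler_sum => c /hv[t <-]; rewrite (bigD1 t) //= lerDl sumr_ge0 //.
rewrite (exchange_big_dep predT) //=; apply: ler_sum => t _.
apply: (@le_trans _ _ (\sum_(c <- cs | c == v t) F (v t))).
  rewrite big_mkcond [leRHS]big_mkcond; apply: ler_sum => c _.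
  by rewrite eq_sym; case: (P c); case: (c == v t) => //=.
rewrite big_const_seq iter_addr_0 (count_uniq_mem _ ucs).
by case: (_ \in _); rewrite ?mulr1n ?mulr0n.
Qed.

Lemma geometric_tail_le {R : realType} (x : R) (q0 Q : nat) : 0 < x < 1 ->
  \sum_(q < Q) (if (q0 <= q)%N then x ^+ q else 0) <= x ^+ q0 / (1 - x).
Proof.
move=> /andP[x0 x1]; rewrite ler_pdivlMr ?subr_gt0 //.
(* The sum telescopes to this value; [maxn] covers the case [Q <= q0], where both sides vanish. *)
apply: (@le_trans _ _ (x ^+ q0 - x ^+ maxn q0 Q)); last first.
  by rewrite gerBl exprn_ge0 // ltW.
elim: Q => [|Q IH]; first by rewrite big_ord0 mul0r maxn0 subrr.
rewrite big_ord_recr /= mulrDl; case: leqP => hQ.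
  move: IH; rewrite (maxn_idPr hQ) (maxn_idPr (leqW hQ)) exprS.
  by lra.
by rewrite mul0r addr0 (maxn_idPl hQ); move: IH; rewrite (maxn_idPl (ltnW hQ)).
Qed.

Lemma plane_dist_le {R : realType} (p q : R * R) :
  plane_dist p q <= `|p.1 - q.1| + `|p.2 - q.2|.
Proof.
rewrite /plane_dist; set x := p.1 - _; set y := p.2 - _.
have -> : `|x| + `|y| = Num.sqrt ((`|x| + `|y|) ^+ 2).
  by rewrite sqrtr_sqr [RHS]ger0_norm // addr_ge0.
apply: ler_wsqrtr; rewrite -(real_normK (num_real x)) -(real_normK (num_real y)).
by have := mulr_ge0 (normr_ge0 x) (normr_ge0 y); nra.
Qed.

(** * Upper bound by approximate squares of large weight *)

Section GeneralUpper.
Context {R : realType} (W H : finType) (tau : W -> H).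
Context (fx : W -> R -> R) (fy : H -> R -> R) (N M b B : R).
Context (K : set (R * R)).
Let mult h := #|[pred w | tau w == h]|.
Hypothesis mult_gt0 : forall h, (0 < mult h)%N.
Hypothesis H0 : (0 < #|H|)%N.
Hypothesis N1 : 1 < N.
Hypothesis M1 : 1 < M.
Hypothesis b01 : 0 < b < 1.
Hypothesis NbM : N `^ b = M.
Hypothesis simx : similarities fx N.
Hypothesis simy : similarities fy M.
Hypothesis B0 : 0 < B.
Hypothesis hB : forall p, K p -> `|p.1| <= B /\ `|p.2| <= B.
Hypothesis KS : forall p, K p ->
  exists w p', K p' /\ p = (fx w p'.1, fy (tau w) p'.2).

Let Z : R := \sum_h (mult h)%:R `^ b.

(* The pair (u, v) codes the approximate square fixing the letters u and below
   them the H-letters v.  The weights are the masses given by McMullen's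
   Bernoulli measure. *)
Let letter_weight w : R := (b - 1) * ln (mult (tau w))%:R - ln Z.
Let type_weight h : R := b * ln (mult h)%:R - ln Z.
Let weight (c : seq W * seq H) : R :=
  expR (\sum_(w <- c.1) letter_weight w + \sum_(h <- c.2) type_weight h).
Let level (c : seq W * seq H) := (size c.1 + size c.2)%N.

Let mult_pos h : 0 < (mult h)%:R :> R. Proof. by rewrite ltr0n. Qed.

Let Z0 : 0 < Z.
Proof.
case/card_gt0P: H0 => x _; rewrite /Z (bigD1 x) //= ltr_pwDl ?powR_gt0 //.
by rewrite sumr_ge0 // => i _; exact: powR_ge0.
Qed.

Let sum_type_weight : \sum_h expR (type_weight h) = 1.
Proof.
rewrite /type_weight (eq_bigr (fun h => (mult h)%:R `^ b / Z)); last first.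
  by move=> h _; rewrite expRD expRN lnK ?posrE // /powR gt_eqF.
by rewrite -mulr_suml divff // gt_eqF.
Qed.

(** A type [h] has mass mult(h)^b / Z, shared equally among the letters of its fibre. *)
Let sum_letter_weight : \sum_w expR (letter_weight w) = 1.
Proof.
rewrite (partition_big tau predT) //= -sum_type_weight; apply: eq_bigr => h _.
rewrite (eq_bigr (fun=> expR (type_weight h) / (mult h)%:R)); last first.
  move=> w /eqP <-; rewrite /letter_weight /type_weight.
  rewrite -{3}(lnK (x := (mult (tau w))%:R)) ?posrE // -expRN -expRD.
  by congr expR; ring.
rewrite sumr_const -(mulr_natr (_ / _)) -[X in _ * X%:R]/(mult h).
by rewrite divfK // gt_eqF.
Qed.

Let sum_weight (l r : nat) :
  \sum_(t : l.-tuple W * r.-tuple H) weight (val t.1, val t.2) = 1.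
Proof.
rewrite -(pair_bigA _ (fun u v => weight (val u, val v))) /=.
rewrite (eq_bigr (fun u : l.-tuple W => \prod_i expR (letter_weight (tnth u i)))).
  rewrite (sum_tuple_prod (fun _ w => expR (letter_weight w))).
  by rewrite big1 // => i _.
move=> u _.
rewrite (eq_bigr (fun v : r.-tuple H => \prod_i expR (letter_weight (tnth u i)) *
    \prod_i expR (type_weight (tnth v i)))).
  rewrite -mulr_sumr (sum_tuple_prod (fun _ h => expR (type_weight h))).
  by rewrite [X in _ * X]big1 ?mulr1.
move=> v _; rewrite /weight /= expRD !expR_sum.
by rewrite !(big_tuple _ _ _ predT).
Qed.

(** With S(j) the sum of the logarithmic multiplicities of the first j letters, the exponent is b
    S(q) - S(l) - q ln Z, the combination that [mcmullen_limsup] controls. *)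
Let weight_split (u1 u2 : seq W) : weight (u1, map tau u2) =
  expR (b * (\sum_(w <- u1 ++ u2) ln (mult (tau w))%:R)
        - \sum_(w <- u1) ln (mult (tau w))%:R
        - (size u1 + size u2)%:R * ln Z).
Proof.
rewrite /weight /=; congr expR; rewrite big_map big_cat /= natrD.
have -> : \sum_(w <- u1) letter_weight w =
    (b - 1) * \sum_(w <- u1) ln (mult (tau w))%:R - (size u1)%:R * ln Z.
  elim: u1 => [|w u IH] /=; first by rewrite !big_nil; ring.
  by rewrite !big_cons IH /letter_weight -natr1; ring.
have -> : \sum_(w <- u2) type_weight (tau w) =
    b * \sum_(w <- u2) ln (mult (tau w))%:R - (size u2)%:R * ln Z.
  elim: u2 => [|w u IH] /=; first by rewrite !big_nil; ring.
  by rewrite !big_cons IH /type_weight -natr1; ring.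
by ring.
Qed.

(** The radii are those of the image of [-B, B]^2, which contains [K], so the box holds every point
    of [K] coded by [c]. *)
Let box (c : seq W * seq H) : set (R * R) := [set p |
  `|p.1 - comp_word fx c.1 0| <= B / N ^+ size c.1 /\
  `|p.2 - comp_word fy (map tau c.1 ++ c.2) 0| <= B / M ^+ level c].

(** The rounding of b q costs one letter: N^-l <= N M^-q with l the size of [c.1], whence the factor
    [N + 1]. *)
Let box_diam (c : seq W * seq H) (p p' : R * R) :
  size c.1 = Num.truncn (b * (level c)%:R) -> box c p -> box c p' ->
  plane_dist p p' <= (2 * B * (N + 1)) / M ^+ level c.
Proof.
set q := level c => hs [h1 h2] [h3 h4].
have N0 : 0 < N := lt_trans ltr01 N1.
have M0 : 0 < M := lt_trans ltr01 M1.
have /andP[b0 b1] := b01.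
have NM : (N ^+ size c.1)^-1 <= N / M ^+ q.
  rewrite -[leLHS]mul1r ler_pdivrMr ?exprn_gt0 // mulrAC ler_pdivlMr ?exprn_gt0 //.
  rewrite mul1r -exprS -!powR_mulrn ?(ltW N0) ?(ltW M0) // -NbM -powRrM.
  apply: ler_powR; first exact: ltW.
  by rewrite hs ltW // truncnS_gt.
apply: le_trans (plane_dist_le _ _) _.
have d1 : `|p.1 - p'.1| <= 2 * (B / N ^+ size c.1).
  apply: le_trans (ler_distD (comp_word fx c.1 0) _ _) _.
  by rewrite (distrC _ p'.1); lra.
have d2 : `|p.2 - p'.2| <= 2 * (B / M ^+ q).
  apply: le_trans (ler_distD (comp_word fy (map tau c.1 ++ c.2) 0) _ _) _.
  by rewrite (distrC _ p'.2); lra.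
have d3 : B / N ^+ size c.1 <= B * (N / M ^+ q) by rewrite ler_pM2l.
by lra.
Qed.

(** Boxes of weight at least exp(-(ln Z + eps) q) at levels q >= q0 already cover [K]. For such a
    box M^(-q s) is at most x^q times its weight, so level q contributes at most E^s x^q, and the
    geometric tail is small. *)
Lemma general_upper (s : R) : 0 <= s -> ln Z < s * ln M ->
  hausdorff_measure (@plane_dist R) s K = 0%E.
Proof.
move=> s0 hs; apply: hausdorff_null => delta e d0 e0.
have N0 : 0 < N := lt_trans ltr01 N1.
have M0 : 0 < M := lt_trans ltr01 M1.
have /andP[b0 b1] := b01.
(* Half of the gap is spent on the weight bound, the other half becomes the geometric ratio [x]. *)
pose eps := (s * ln M - ln Z) / 2.
have eps0 : 0 < eps by rewrite divr_gt0 // subr_gt0.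
pose x := expR (- eps).
have x01 : 0 < x < 1 by rewrite expR_gt0 -expR0 ltr_expR oppr_lt0.
pose E := 2 * B * (N + 1).
have E0 : 0 < E by rewrite !mulr_gt0 // addr_gt0.
have Es0 : 0 < E `^ s by rewrite powR_gt0.
(* [q1] brings the diameters down to [delta], and [q2] below brings the tail of the cover sum down
   to [e]. *)
have [q1 hq1] := expr_inv_small M1 (divr_gt0 d0 E0).
have xi1 : 1 < x^-1 by rewrite -expRN opprK expR_gt1.
have c0 : 0 < e * (1 - x) / E `^ s.
  by case/andP: x01 => _ x1; rewrite divr_gt0 // mulr_gt0 // subr_gt0.
have [q2 hq2] := expr_inv_small xi1 c0.
pose q0 := maxn q1 q2.
have Eq q : (q0 <= q)%N -> E / M ^+ q <= delta.
  move=> hq; rewrite -ler_pdivlMl // mulrC; apply: le_trans hq1.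
  rewrite lef_pV2 ?posrE ?exprn_gt0 // ler_weXn2l ?(ltW M1) //.
  exact: leq_trans (leq_maxl _ _) hq.
have xq0 : E `^ s * (x ^+ q0 / (1 - x)) <= e.
  case/andP: x01 => x0 x1; rewrite mulrA ler_pdivrMr ?subr_gt0 // -ler_pdivlMl //.
  rewrite mulrC; apply: le_trans hq2; rewrite exprVn invrK.
  by rewrite ler_wiXn2l ?(ltW x0) ?(ltW x1) // leq_maxr.
pose good (c : seq W * seq H) := [&& (q0 <= level c)%N,
  size c.1 == Num.truncn (b * (level c)%:R)
  & expR (- (ln Z + eps) * (level c)%:R) <= weight c].
pose U c := if good c then box c else set0.
pose g c := if good c then E `^ s * x ^+ level c * weight c else 0.
have dbox c : good c -> (diam (@plane_dist R) (box c) <= (E / M ^+ level c)%:E)%E.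
  case/and3P => _ /eqP hc _; apply: diam_le; last first.
    by move=> p p'; exact: box_diam.
  by rewrite divr_ge0 ?ltW // exprn_gt0.
apply: (@premeasure_countable_cover R _ _ _ U g) => //.
- exact: ltW.
- move=> p Kp; have [om hom] := coding KS Kp.
  pose S q := \sum_(w <- mkseq om q) ln (mult (tau w))%:R : R.
  have S0 q : 0 <= S q.
    by rewrite /S sumr_ge0 // => w _; rewrite ln_ge0 // ler1n.
  have [q hq hS] := mcmullen_limsup q0 b01 eps0 S0.
  set l := Num.truncn _ in hS.
  have lq : (l <= q)%N.
    rewrite -(ler_nat R) (le_trans (y := b * q%:R)) //.
      by rewrite truncn_le mulr_ge0 // ltW.
    by rewrite ler_piMl // ltW.
  pose u := mkseq om l; pose v := drop l (mkseq om q).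
  have uv : u ++ v = mkseq om q.
    rewrite -[RHS](cat_take_drop l); congr (_ ++ _).
    by rewrite /u /mkseq -map_take take_iota (minn_idPl lq).
  have su : size u = l by rewrite size_mkseq.
  have sv : size v = (q - l)%N by rewrite size_drop size_mkseq.
  have lvl : level (u, map tau v) = q by rewrite /level /= size_map su sv subnKC.
  have gc : good (u, map tau v).
    apply/and3P; rewrite lvl /= su; split=> //.
    rewrite weight_split uv ler_expR su sv subnKC // -/(S q) -/(S l).
    by lra.
  exists (u, map tau v) => //; rewrite /U gc; rewrite /box /= lvl su.
  have close (X : Type) (f : X -> R -> R) (A y z : R) (k : seq X) : 0 < A ->
      similarities f A -> `|y| <= B -> z = comp_word f k y ->
      `|z - comp_word f k 0| <= B / A ^+ size k.
    move=> A0 sf hy ->; rewrite (comp_word_similar sf) subr0.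
    by rewrite ler_pM2r // invr_gt0 exprn_gt0.
  (* The horizontal side uses the tail after [l] letters, the vertical side the tail after [q]
     letters of the same code. *)
  have [p1 Kp1 [e1 _]] := hom l; have [p2 Kp2 [_ e2]] := hom q.
  split.
    by rewrite -su; apply: (close _ _ _ p1.1) => //; have [] := hB Kp1.
  rewrite -map_cat uv.
  have -> : q = size (map tau (mkseq om q)) by rewrite size_map size_mkseq.
  rewrite [in X in comp_word fy X]size_map size_mkseq.
  by apply: (close _ _ _ p2.2) => //; have [] := hB Kp2.
- move=> c; rewrite /U; case: ifP => [gc|_]; last first.
    by apply: diam_le => [|? ? []]; exact: ltW.
  apply: le_trans (dbox c gc) _; rewrite lee_fin Eq //.
  by case/and3P: gc.
- move=> c; rewrite /U /g; case: ifP => [gc|_]; last first.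
    by rewrite /diam_pow; case: asboolP.
  apply: le_trans (diam_pow_le s0 _ (dbox c gc)) _.
    by rewrite divr_ge0 ?ltW // exprn_gt0.
  rewrite lee_fin powRM ?invr_ge0 ?exprn_ge0 ?(ltW E0) ?(ltW M0) //.
  rewrite -mulrA ler_pM2l //.
  have /and3P[_ _ hw] := gc; set q := level c in hw *.
  have -> : (M ^+ q)^-1 `^ s = expR (- eps * q%:R) * expR (- (ln Z + eps) * q%:R).
    rewrite /powR gt_eqF ?invr_gt0 ?exprn_gt0 // lnV ?posrE ?exprn_gt0 // lnXn //.
    by rewrite -expRD -mulr_natr; congr expR; rewrite /eps; field.
  have -> : x ^+ q = expR (- eps * q%:R) by rewrite mulrC expRM_natl.
  by rewrite ler_pM2l // expR_gt0.
- move=> cs ucs; apply: le_trans xq0.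
  (* A finite list meets finitely many levels, and the weights on each level sum to at most 1. *)
  pose Q := (\max_(c <- cs) level c).+1.
  apply: le_trans (_ : _ <= E `^ s *
    \sum_(q < Q) (if (q0 <= q)%N then x ^+ q else 0)) _; last first.
    by rewrite ler_pM2l // geometric_tail_le.
  have lQ c : c \in cs -> (level c < Q)%N.
    by move=> hc; rewrite ltnS; apply: leq_bigmax_seq.
  rewrite (eq_big_seq (fun c => \sum_(q < Q) if level c == q then g c else 0));
    last first.
    move=> c /lQ lc; rewrite (bigD1 (Ordinal lc)) //= eqxx big1 ?addr0 // => q.
    by rewrite -val_eqE /= eq_sym => /negbTE ->.
  rewrite exchange_big /= mulr_sumr; apply: ler_sum => q _.
  case: leqP => hq; last first.
    rewrite mulr0 big1 // => c _; case: eqP => // e1.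
    by rewrite /g /good e1 leqNgt hq.
  pose l := Num.truncn (b * q%:R).
  pose P (c : seq W * seq H) := (size c.1 == l) && (size c.2 == q - l)%N.
  apply: (@le_trans _ _ (\sum_(c <- cs | P c) E `^ s * x ^+ q * weight c)).
    rewrite [leRHS]big_mkcond; apply: ler_sum => c _.
    have nn : 0 <= E `^ s * x ^+ q * weight c.
      by rewrite !mulr_ge0 ?ltW ?exprn_gt0 // expR_gt0.
    case: eqP => [e1|_]; last by case: ifP.
    rewrite /g e1; case: ifP => [/and3P[_ /eqP h _]|_]; last by case: ifP.
    have hl : size c.1 = l by rewrite h e1.
    have -> : P c by rewrite /P /= hl eqxx -e1 /level hl addKn /=.
    by rewrite lexx.
  rewrite -mulr_sumr -[leRHS]mulr1 ler_pM2l ?mulr_gt0 ?exprn_gt0 //; last first.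
    by case/andP: x01.
  rewrite -(sum_weight l (q - l)).
  apply: (@sum_uniq_le _ _ _
    (fun t : l.-tuple W * (q - l).-tuple H => (val t.1, val t.2))) => //.
    by move=> c; exact: ltW (expR_gt0 _).
  move=> [u v] /andP[/= hu hv].
  by exists (Tuple hu, Tuple hv).
Qed.

End GeneralUpper.

(** * The distinct weak maps as a finite type *)

Section RangeFinType.
Import mathcomp.finmap.finmap.

(** The abstract bounds need a finite alphabet [H] of weak letters; here the distinct values of [G]
    become one, with [tau] sending a word to its value. *)
Lemma range_finType (R : realType) (W : finType) (X : choiceType) (G : W -> X) :
  exists (H : finType) (tau : W -> H) (v : H -> X),
  [/\ injective v, forall w, v (tau w) = G w, forall h, exists w, tau w = h
    & forall F : X -> R, \sum_(x \in range G) F x = \sum_h F (v h)].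
Proof.
have fin : finite_set (range G) by apply: finite_image; exact: finite_finset.
pose A := fset_set (range G).
have GA w : G w \in A by rewrite in_fset_set //; apply/mem_set; exists w.
exists A, (fun w => FSetSub (GA w)), val; split=> //.
- move=> [h hA]; have := hA; rewrite in_fset_set // => /set_mem[w _ e].
  by exists w; apply: val_inj.
- by move=> F; rewrite fsbig_finite // big_seq_fsetE.
Qed.

End RangeFinType.

(** * Coordinate maps of the carpet and the cells of the grid *)

Section Carpet.
Context {R : realType} (n m : nat) (D : {set digit n m}).
Context (sigma eta : digit n m -> R).
Hypothesis n2 : (1 < n)%N.
Hypothesis m2 : (1 < m)%N.
Hypothesis hsigma : forall d, d \in D -> sigma d = -1 \/ sigma d = 1.
Hypothesis heta : forall d, d \in D -> eta d = -1 \/ eta d = 1.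

Let letter := {d : digit n m | d \in D}.
Let gx (d : letter) (x : R) : R := (sigma (val d) * x + shift_a sigma (val d)) / n%:R.
Let gy (d : letter) : R -> R := weak_map eta (val d).

Let n0 : 0 < n%:R :> R. Proof. by rewrite ltr0n ltnW. Qed.
Let m0 : 0 < m%:R :> R. Proof. by rewrite ltr0n ltnW. Qed.

Lemma sign_similar (e a x y p : R) : e = -1 \/ e = 1 -> 0 < p ->
  `|(e * x + a) / p - (e * y + a) / p| = `|x - y| / p.
Proof.
move=> he p0; have -> : (e * x + a) / p - (e * y + a) / p = e * (x - y) / p by ring.
rewrite !normrM (gtr0_norm (x := p^-1)) ?invr_gt0 //.
by case: he => ->; rewrite ?normrN1 ?normr1 mul1r.
Qed.

Lemma sign_surj (e a p z : R) : e = -1 \/ e = 1 -> 0 < p ->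
  exists x, (e * x + a) / p = z.
Proof.
move=> he p0; exists (e * (z * p - a)).
have -> : e * (e * (z * p - a)) = z * p - a.
  by case: he => ->; rewrite ?mulN1r ?opprK ?mul1r.
by field; rewrite gt_eqF.
Qed.

(** The shift by i + 1 compensates the reflection, so for either sign the open unit interval lands
    in the cell of digit [i]. *)
Lemma sign_cell (e x p : R) (i : nat) : e = -1 \/ e = 1 -> 0 < p -> 0 < x < 1 ->
  i%:R < (e * x + (if e == 1 then i%:R else i.+1%:R)) / p * p < i%:R + 1.
Proof.
move=> he p0 /andP[x0 x1]; rewrite divfK ?(gt_eqF p0) // -natr1; case: he => ->.
  by rewrite lt_eqF ?ltrN10 ?(lt_trans _ ltr01) ?ltrN10 //; apply/andP; split; lra.
by rewrite eqxx; apply/andP; split; lra.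
Qed.

Lemma gx_similar : similarities gx n%:R.
Proof. by move=> d x y; apply: sign_similar => //; apply/hsigma/valP. Qed.

Lemma gy_similar : similarities gy m%:R.
Proof. by move=> d x y; apply: sign_similar => //; apply/heta/valP. Qed.

Lemma gx_surj d z : exists x, gx d x = z.
Proof. by apply: sign_surj => //; apply/hsigma/valP. Qed.

Lemma gy_surj d z : exists y, gy d y = z.
Proof. by apply: sign_surj => //; apply/heta/valP. Qed.

Lemma gx_cell (d : letter) (x : R) : 0 < x < 1 -> (val d).1%:R < gx d x * n%:R < (val d).1%:R + 1.
Proof. by move=> hx; apply: sign_cell => //; apply/hsigma/valP. Qed.

Lemma gy_cell (d : letter) (y : R) : 0 < y < 1 -> (val d).2%:R < gy d y * m%:R < (val d).2%:R + 1.
Proof. by move=> hy; apply: sign_cell => //; apply/heta/valP. Qed.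

Lemma cell_unit (z p : R) (i k : nat) : (i < k)%N -> p = k%:R ->
  i%:R < z * p < i%:R + 1 -> 0 < z < 1.
Proof.
move=> ik -> /andP[h1 h2]; have k0 : 0 < k%:R :> R by rewrite ltr0n (leq_ltn_trans _ ik).
apply/andP; split; first by rewrite -(pmulr_lgt0 _ k0) (le_lt_trans _ h1).
by rewrite -(ltr_pM2r k0) mul1r (lt_le_trans h2) // natr1 ler_nat.
Qed.

Lemma cell_digit_inj (z p : R) (i j : nat) :
  i%:R < z * p < i%:R + 1 -> j%:R < z * p < j%:R + 1 -> i = j.
Proof.
move=> /andP[h1 h2] /andP[h3 h4]; apply/eqP; rewrite eqn_leq.
by apply/andP; split; rewrite -ltnS -(ltr_nat R) -natr1; lra.
Qed.

Lemma gx_unit (u : seq letter) (x : R) : 0 < x < 1 -> 0 < comp_word gx u x < 1.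
Proof.
elim: u => //= d u IH /IH /(gx_cell d); apply: cell_unit => //; exact: ltn_ord.
Qed.

Lemma gy_unit (u : seq letter) (y : R) : 0 < y < 1 -> 0 < comp_word gy u y < 1.
Proof.
elim: u => //= d u IH /IH /(gy_cell d); apply: cell_unit => //; exact: ltn_ord.
Qed.

Lemma similarities_inj (T : Type) (f : T -> R -> R) (p : R) d :
  0 < p -> similarities f p -> injective (f d).
Proof.
move=> p0 hf x y e; have := hf d x y; rewrite e subrr normr0 => /esym/eqP.
by rewrite mulf_eq0 invr_eq0 (gt_eqF p0) orbF normr_eq0 subr_eq0 => /eqP.
Qed.

(** The open cell containing a point determines the first digit, so equal images force equal first
    letters, which are injective and can be peeled off. Equal heights are assumed so as to obtain
    horizontal disjointness inside a fibre of weak maps. *)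
Lemma word_squares_disjoint (u u' : seq letter) (x y x' y' : R) : size u = size u' -> u <> u' ->
  0 < x < 1 -> 0 < y < 1 -> 0 < x' < 1 -> 0 < y' < 1 ->
  comp_word gy u y = comp_word gy u' y' ->
  comp_word gx u x <> comp_word gx u' x'.
Proof.
elim: u u' => [|d u IH] [|d' u'] //= [hs] hne hx hy hx' hy' ey ex.
have dd : d = d'.
  apply/val_inj; rewrite [LHS]surjective_pairing [RHS]surjective_pairing.
  congr pair; apply/ord_inj.
    apply: (@cell_digit_inj (gx d (comp_word gx u x)) n%:R).
      exact/gx_cell/gx_unit.
    by rewrite ex; exact/gx_cell/gx_unit.
  apply: (@cell_digit_inj (gy d (comp_word gy u y)) m%:R).
    exact/gy_cell/gy_unit.
  by rewrite ey; exact/gy_cell/gy_unit.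
rewrite -dd in ex ey hne.
move/(similarities_inj n0 gx_similar): ex; move/(similarities_inj m0 gy_similar): ey.
by apply: IH => // e; apply: hne; rewrite e.
Qed.

Lemma word_map_letters (u : seq letter) :
  comp_word gy u = word_map eta (map val u).
Proof. by elim: u => //= d u ->. Qed.

(** * Words acting on the carpet, and passage from digits to letters *)

Variables (K : set (R * R)) (hK : is_reflected_carpet D sigma eta K).

Lemma carpet_word (u : seq letter) p : K p -> K (comp_word gx u p.1, comp_word gy u p.2).
Proof.
move=> Kp; elim: u => [|d u IH] /=; first by case: p Kp.
have [_ _ ->] := hK; exists (val d); first exact: valP d.
by exists (comp_word gx u p.1, comp_word gy u p.2).
Qed.

Lemma carpet_preimage k p : K p -> exists (u : k.-tuple letter) p', K p' /\
  p = (comp_word gx u p'.1, comp_word gy u p'.2).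
Proof.
elim: k p => [|k IH] p Kp.
  by exists [tuple], p; split=> //=; case: p Kp.
have [_ _ eK] := hK; move: (Kp); rewrite {1}eK => -[d dD [p1 Kp1 e1]].
have [u [p2 [Kp2 e2]]] := IH p1 Kp1.
exists [tuple of (exist _ d dD : letter) :: u], p2; split=> //.
by rewrite -e1 e2.
Qed.

Lemma words_letters k (w : k.-tuple (digit n m)) : w \in words D k ->
  exists u : k.-tuple letter, map_tuple val u = w.
Proof.
rewrite inE => /allP hw.
have hw' i : tnth w i \in D by apply: hw; exact: mem_tnth.
exists [tuple (exist _ (tnth w i) (hw' i) : letter) | i < k].
by apply: eq_from_tnth => i; rewrite !tnth_map tnth_ord_tuple.
Qed.

Lemma letters_words k (u : k.-tuple letter) : map_tuple val u \in words D k.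
Proof. by rewrite inE; apply/allP => d /mapP[e _ ->]; exact: valP e. Qed.

Lemma weak_maps_letters k : weak_maps D eta k =
  range (fun w : k.-tuple letter => comp_word gy w).
Proof.
apply/seteqP; split=> h.
  by move=> [w /= /words_letters[u <-] <-]; exists u; rewrite ?word_map_letters.
move=> [w _ <-]; exists (map_tuple val w); last by rewrite /= word_map_letters.
exact: letters_words.
Qed.

Lemma multiplicity_letters k h : multiplicity D eta k h =
  #|[pred w : k.-tuple letter | `[< comp_word gy w = h >]]|.
Proof.
rewrite /multiplicity -(fintype.card_image (f := map_tuple val)); last first.
  by move=> w w' /(congr1 val) /= /(inj_map val_inj) /val_inj.
apply: eq_card => w; rewrite inE; apply/andP/fintype.imageP.
  move=> [/words_letters[u <-] hu]; exists u => //.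
  by rewrite inE word_map_letters; exact/asboolP.
move=> [u hu ->]; split; first exact: letters_words.
by move: hu; rewrite inE word_map_letters => /asboolP.
Qed.

(** * The dimension as a threshold, and the formula for the carpet *)

Lemma hausdorff_dim_eq (A : set (R * R)) (t : R) : 0 <= t ->
  (forall s, 0 <= s -> s < t -> hausdorff_measure (@plane_dist R) s A <> 0%E) ->
  (forall s, t < s -> hausdorff_measure (@plane_dist R) s A = 0%E) ->
  hausdorff_dim (@plane_dist R) A = t%:E.
Proof.
move=> t0 lo up; apply/eqP; rewrite eq_le; apply/andP; split.
  apply/lee_addgt0Pr => e e0; apply: ereal_inf_lbound; exists (t + e) => //=.
  by split; [rewrite addr_ge0 // ltW | apply: up; rewrite ltrDl].
apply: le_ereal_inf_tmp => _ [s /= [s0 hs] <-]; rewrite lee_fin leNgt.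
by apply/negP => st; exact: (lo s s0 st).
Qed.

(** The two general bounds are applied with the words of length [k] as letters, the distinct weak
    maps as [H], and the ratios n^k and m^k. Horizontal separation comes from the unit interval,
    vertical separation from the assumed open set. *)
Lemma carpet_dim (k : nat) : (0 < k)%N -> (m < n)%N -> D != finset.set0 ->
  open_set_condition (weak_maps D eta k) ->
  hausdorff_dim (@plane_dist R) K =
    (1 / (k%:R * ln m%:R) *
      ln (\sum_(h \in weak_maps D eta k)
            (multiplicity D eta k h)%:R `^ (ln m%:R / ln n%:R : R)))%:E.
Proof.
move=> k0 hmn /set0Pn[d dD] [V [V0 _ oV hV Vdis]].
set b : R := ln m%:R / ln n%:R.
have [H [tau [v [vinj vtau surj sumH]]]] :=
  range_finType R (fun w : k.-tuple letter => comp_word gy w).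
rewrite weak_maps_letters sumH.
pose mult h := #|[pred w | tau w == h]|.
have multE h : multiplicity D eta k (v h) = mult h.
  rewrite multiplicity_letters; apply: eq_card => w; rewrite !inE -vtau.
  by apply/asboolP/eqP => [/vinj|->].
rewrite (eq_bigr (fun h => (mult h)%:R `^ b)); last by move=> h _; rewrite multE.
set Z := \sum_h _.
have mult_gt0 h : (0 < mult h)%N.
  by have [w hw] := surj h; apply/card_gt0P; exists w; rewrite inE hw.
have H0 : (0 < #|H|)%N.
  by apply/card_gt0P; exists (tau [tuple of nseq k (exist _ d dD : letter)]).
have n1 : 1 < n%:R :> R by rewrite ltr1n.
have m1 : 1 < m%:R :> R by rewrite ltr1n.
have ln_n : 0 < ln n%:R :> R by rewrite ln_gt0.
have ln_m : 0 < ln m%:R :> R by rewrite ln_gt0.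
have b01 : 0 < b < 1.
  by rewrite divr_gt0 //= ltr_pdivrMr // mul1r ltr_ln ?posrE // ltr_nat.
have NbM : (n%:R ^+ k) `^ b = m%:R ^+ k :> R.
  by rewrite exprn_powR ?ler0n // /powR gt_eqF // divfK ?gt_eqF // lnK ?posrE.
have N1 : 1 < n%:R ^+ k :> R by rewrite expr_gt1 // ltW.
have M1 : 1 < m%:R ^+ k :> R by rewrite expr_gt1 // ltW.
pose X (w : k.-tuple letter) := comp_word gx w.
have simX : similarities X (n%:R ^+ k).
  by apply: similarities_blocks gx_similar => w; rewrite size_tuple.
have simY : similarities v (m%:R ^+ k).
  move=> h x y; have [w <-] := surj h; rewrite vtau.
  by rewrite (comp_word_similar gy_similar) size_tuple.
have sepX : separated tau X (n%:R ^+ k).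
  apply: (@osc_separated _ _ _ _ _ _ [set` `]0, 1[ : interval R]) => //.
  - by rewrite exprn_gt0.
  - by move=> w; exact/comp_word_surj/gx_surj.
  - by exists 2^-1; rewrite /= in_itv /=; apply/andP; split; lra.
  - by move=> w x; rewrite /= !in_itv; exact: gx_unit.
  - move=> w w' /(congr1 v); rewrite !vtau => ey ww' x y.
    rewrite /= !in_itv => hx hy.
    (* Words with the same weak map send 1/2 to the same height, so disjointness of the squares
       separates them horizontally. *)
    have h2 : 0 < (2^-1 : R) < 1 by apply/andP; split; lra.
    apply: (@word_squares_disjoint w w' _ 2^-1 _ 2^-1) => //.
    - by rewrite !size_tuple.
    - by move=> /val_inj.
    - by rewrite ey.
have wv h : weak_maps D eta k (v h).
  by have [w <-] := surj h; rewrite vtau weak_maps_letters; exists w.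
have sepY : separated (fun _ : H => tt) v (m%:R ^+ k).
  apply: (@osc_separated _ _ _ _ _ _ V) => //.
  - by rewrite exprn_gt0.
  - move=> h z; have [w <-] := surj h; rewrite vtau.
    exact: (comp_word_surj gy_surj).
  - by move=> h x Vx; apply: (hV _ (wv h)); exists x.
  - move=> h h' _ hh' x y Vx Vy e.
    have : (v h @` V `&` v h' @` V) (v h x).
      by split; [exists x | rewrite e; exists y].
    by rewrite Vdis // => /vinj.
have [K0 cK _] := hK; have [p0 Kp0] := K0.
have KS u : K (comp_word X u p0.1, comp_word v (map tau u) p0.2).
  elim: u => [|w u IH] /=; first by case: p0 Kp0.
  by rewrite vtau; exact: (carpet_word w IH).
have [B hB] := compact_plane_bounded cK.
have B1 : 0 < Num.max B 1 by rewrite lt_max ltr01 orbT.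
have hB' p : K p -> `|p.1| <= Num.max B 1 /\ `|p.2| <= Num.max B 1.
  by move=> /hB[h1 h2]; rewrite !le_max h1 h2.
have Kpre p : K p -> exists w p', K p' /\ p = (X w p'.1, v (tau w) p'.2).
  by move=> /(carpet_preimage k)[w [p' [Kp' e]]]; exists w, p'; rewrite vtau.
(* Some multiplicity is at least 1; hence ln Z >= 0 and the claimed dimension is nonnegative. *)
have Z1 : 1 <= Z.
  case/card_gt0P: (H0) => h _; rewrite /Z (bigD1 h) //=.
  rewrite (le_trans (y := (mult h)%:R `^ b)) //; last first.
    by rewrite lerDl sumr_ge0 // => i _; exact: powR_ge0.
  apply: (@le_trans _ _ (1 `^ b)); first by rewrite powR1.
  apply: ge0_ler_powR; rewrite ?nnegrE ?ler1n //.
  by case/andP: b01 => /ltW.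
have lM : ln (m%:R ^+ k) = k%:R * ln m%:R :> R by rewrite lnXn // mulr_natl.
have k0R : 0 < k%:R :> R by rewrite ltr0n.
have lM0 : 0 < k%:R * ln m%:R :> R by rewrite mulr_gt0.
rewrite mul1r mulrC; apply: hausdorff_dim_eq.
- by rewrite divr_ge0 ?ln_ge0 // ltW.
- move=> s s0; rewrite ltr_pdivlMr // -lM => hs.
  have b01' : 0 < b <= 1 by case/andP: b01 => -> /ltW.
  exact: (general_lower mult_gt0 H0 N1 M1 b01' NbM simX simY sepX sepY cK KS s0 hs).
- move=> s st; have s0 : 0 <= s.
    by apply: le_trans (ltW st); rewrite divr_ge0 ?ln_ge0 // ltW.
  move: st; rewrite ltr_pdivrMr // -lM => hs.
  exact: (general_upper mult_gt0 H0 N1 M1 b01 NbM simX simY B1 hB' Kpre s0 hs).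
Qed.

End Carpet.

Theorem theorem4p5 (R : realType) (n m : nat) (hm : (2 <= m)%N)
  (hmn : (m < n)%N)
  (D : {set 'I_n * 'I_m}) (hD : D != finset.set0)
  (sigma eta : 'I_n * 'I_m -> R)
  (hsigma : forall d, d \in D -> sigma d = -1 \/ sigma d = 1)
  (heta : forall d, d \in D -> eta d = -1 \/ eta d = 1)
  (K : set (R * R)) (hK : is_reflected_carpet D sigma eta K)
  (k : nat) (hk : (1 <= k)%N)
  (hosc : open_set_condition (weak_maps D eta k)) :
  let beta : R := ln m%:R / ln n%:R in
  hausdorff_dim (@plane_dist R) K =
    (1 / (k%:R * ln m%:R) *
      ln (\sum_(h \in weak_maps D eta k)
            (multiplicity D eta k h)%:R `^ beta))%:E.
Proof.
move=> beta.
exact: (carpet_dim (leq_trans hm (ltnW hmn)) hm hsigma heta hK hk hmn hD hosc).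
Qed.
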